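(* Let $(\mathcal{G},A_V,A_E)$ be a polynomial succinct graph representation that has a polynomial expansion of independent sets. Then there is an algorithm that, given an instance $x$, enumerates the maximal independent sets of $\mathcal{G}(x)$ in incremental polynomial time.
   Context: A succinct graph representation (SGR) is a triple $(\mathcal{G},A_V,A_E)$ where $\mathcal{G}$ maps strings $x$ (instances) to finite undirected graphs $\mathcal{G}(x)$; $A_V$ is an enumeration algorithm that, given $x$, enumerates the nodes of $\mathcal{G}(x)$ (each exactly once); and $A_E$ is an algorithm that, given $x$ and two nodes $u,v$ of $\mathcal{G}(x)$, decides whether $u$ and $v$ are adjacent in $\mathcal{G}(x)$. The SGR is polynomial if $A_V$ enumerates with delay polynomial in $|x|$ and $A_E$ runs in time polynomial in $|x|$. It has a polynomial expansion of independent sets if (1) there is a polynomial $p$ such that every independent set $I$ of $\mathcal{G}(x)$ satisfies $|I|\le p(|x|)$, and (2) there is a polynomial-time algorithm that, given $x$ and an independent set $I$ of $\mathcal{G}(x)$, either determines that $I$ is a maximal independent set or returns a node $v\notin I$ with $I\cup\{v\}$ independent. An enumeration algorithm runs in incremental polynomial time if, after $N$ answers have been printed, the time to produce the next answer (or halt) is polynomial in $|x|+N$; every answer is printed exactly once. *)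

(* Defs.v *)
From mathcomp Require Import all_boot.
Set Implicit Arguments. Unset Strict Implicit. Unset Printing Implicit Defensive.

Definition word := seq bool.

(* The node set is the (finite) set of members of [verts]; adjacency   *)
(* is a symmetric irreflexive relation (only its restriction to the    *)
(* nodes matters).                                                     *)
Record graph := Graph {
  verts : seq word;
  adj : word -> word -> bool;
  adj_sym : forall u v, adj u v = adj v u;
  adj_irr : forall u, adj u u = false
}.

Definition indep (g : graph) (s : seq word) : bool :=
  all (fun u => u \in verts g) s &&
  all (fun u => all (fun v => ~~ adj g u v) s) s.

Definition maximal_indep (g : graph) (s : seq word) : bool :=
  indep g s && all (fun v => (v \in s) || ~~ indep g (v :: s)) (verts g).

Definition enc_word (w : word) : word :=
  flatten [seq [:: true; b] | b <- w] ++ [:: false; false].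
Definition enc_list (s : seq word) : word := flatten (map enc_word s).

(* The output word w represents the set of members of s (s duplicate-free):
   w encodes s listed in some order. *)
Definition represents (w : word) (s : seq word) : bool :=
  w \in [seq enc_list s' | s' <- permutations s].

(* Machine model: deterministic multi-stack machines (finite control,  *)
(* finitely many binary stacks), polynomially equivalent to multi-tape *)
(* Turing machines.  Every instruction costs one time unit, except     *)
(* output of a stack, which costs 1 + its length.                       *)
Inductive instr :=
| Push of nat & bool
| Pop of nat
| Br of nat & nat & nat & nat (* Br s l0 l1 le: jump to l0 / l1 / le if the
                                 top of stack s is 0 / 1 / stack s is empty *)
| Jmp of nat
| Out of nat
| Halt.

Definition prog := seq instr.

Record config := Cfg { pc : nat; stk : nat -> word }.

Definition upd (f : nat -> word) (i : nat) (w : word) : nat -> word :=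
  fun j => if j == i then w else f j.

Definition step (P : prog) (c : config) : option (config * option word * nat) :=
  match nth Halt P (pc c) with
  | Halt => None
  | Push s b => Some (Cfg (pc c).+1 (upd (stk c) s (b :: stk c s)), None, 1)
  | Pop s => Some (Cfg (pc c).+1 (upd (stk c) s (behead (stk c s))), None, 1)
  | Br s l0 l1 le =>
      Some (Cfg (match stk c s with
                 | [::] => le
                 | b :: _ => if b then l1 else l0 end) (stk c), None, 1)
  | Jmp l => Some (Cfg l (stk c), None, 1)
  | Out s => Some (Cfg (pc c).+1 (stk c), Some (stk c s), (size (stk c s)).+1)
  end.

Fixpoint exec (P : prog) (k : nat) (c : config) (t : nat)
  : seq (word * nat) * option nat :=
  match k with
  | 0 => ([::], None)
  | k'.+1 =>
      match step P c with
      | None => ([::], Some t)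
      | Some (c', o, d) =>
          let r := exec P k' c' (t + d) in
          match o with
          | Some w => ((w, t + d) :: r.1, r.2)
          | None => r
          end
      end
  end.

Definition init (ins : seq word) : config := Cfg 0 (fun i => nth [::] ins i).

Definition halts_with (P : prog) (ins : seq word) (outs : seq (word * nat)) (T : nat) :=
  exists k, exec P k (init ins) 0 = (outs, Some T).

(* Polynomial bound shape: every polynomial is bounded by c * (n+1)^c. *)
Definition pbound (c n : nat) : nat := c * n.+1 ^ c.

(* Delays of a run: time to first output, times between consecutive
   outputs, and time from the last output (or start) to halting.  The i-th
   delay is the time needed to produce the next answer (or halt) after i
   answers have been printed. *)
Definition delays (outs : seq (word * nat)) (T : nat) : seq nat :=
  pairmap (fun a b => b - a) 0 (rcons (map snd outs) T).

Definition poly_node_enumerator (G : word -> graph) (AV : prog) : Prop :=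
  exists c, forall x, exists outs T,
    halts_with AV [:: x] outs T /\
    (forall w, w \in map fst outs -> w \in verts (G x)) /\
    (forall v, v \in verts (G x) -> count (pred1 v) (map fst outs) = 1) /\
    (forall d, d \in delays outs T -> d <= pbound c (size x)).

Definition poly_adj_decider (G : word -> graph) (AE : prog) : Prop :=
  exists c, forall x u v, u \in verts (G x) -> v \in verts (G x) ->
    exists outs T,
      halts_with AE [:: x; u; v] outs T /\
      map fst outs = [:: [:: adj (G x) u v]] /\
      T <= pbound c (size x).

Definition polynomial_SGR (G : word -> graph) (AV AE : prog) : Prop :=
  poly_node_enumerator G AV /\ poly_adj_decider G AE.

(* Polynomial expansion of independent sets.  The independent set I is
   given to the algorithm as the encoding of a duplicate-free list s of
   its elements (in any order); the answer is the single word [:: false]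
   ("I is maximal") or true :: v (the node v). *)
Definition poly_expansion (G : word -> graph) : Prop :=
  (exists c, forall x s, uniq s -> indep (G x) s -> size s <= pbound c (size x)) /\
  (exists (B : prog) c, forall x s, uniq s -> indep (G x) s ->
     exists outs T,
       halts_with B [:: x; enc_list s] outs T /\
       T <= pbound c (size x + size (enc_list s)) /\
       exists o, map fst outs = [:: o] /\
         ((o = [:: false] /\ maximal_indep (G x) s) \/
          (exists v, o = true :: v /\ v \in verts (G x) /\ v \notin s /\
                     indep (G x) (v :: s)))).

Definition mis_enumerator_incpoly (G : word -> graph) (P : prog) : Prop :=
  exists c, forall x, exists outs T,
    halts_with P [:: x] outs T /\
    (forall w, w \in map fst outs ->
       exists s, uniq s /\ maximal_indep (G x) s /\ represents w s) /\
    (forall s, uniq s -> maximal_indep (G x) s ->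
       count (fun w => represents w s) (map fst outs) = 1) /\
    (forall i, i <= size outs ->
       nth 0 (delays outs T) i <= pbound c (size x + i)).

(* Main.v *)
(** The answers printed so far are kept in a list [L].  To find the next one, the
    node enumerator is run from scratch; for every node [v] that it outputs and
    every [J] in [L], the set made of [v] and of the members of [J] not adjacent
    to [v] is extended to a maximal independent set, and the first such set
    missing from [L] is the next answer.  A node for which this yields nothing
    new belongs to some member of [L], so at most [|L| p(|x|) + 1] nodes are
    examined between two answers.  If the enumerator stops, then [L] is
    complete: for a maximal independent set [S] outside [L], take [J] in [L]
    sharing as many nodes as possible with [S] and [v] in [S] but not in [J];
    the extension obtained from [v] and [J] is in [L] and shares more nodes
    with [S].

    Sets are only ever compared through adjacency: two maximal independent
    sets differ iff some edge joins them, and [v] belongs to the maximal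
    independent set [J] iff it has no neighbour in [J].

    The algorithm is written in a structured language compiled to the machine;
    the three given programs run inside it by simulation, one instruction per
    loop iteration, and an output of the node enumerator triggers a handler
    that may abort the simulation. *)
Require Import Defs.
From mathcomp Require Import all_boot.
From mathcomp Require Import zify.
Set Implicit Arguments. Unset Strict Implicit. Unset Printing Implicit Defensive.

(** * A structured language and its compilation *)

Inductive cmd :=
| Skip
| CPush of nat & bool
| CPop of nat
| COut of nat
| Seq of cmd & cmd
| If of nat & cmd & cmd & cmd
| While of nat & cmd.

Notation "c1 ;; c2" := (Seq c1 c2) (at level 60, right associativity).

Notation state := (nat -> word).

Fixpoint csz (c : cmd) : nat :=
  match c with
  | Skip => 0
  | CPush _ _ | CPop _ | COut _ => 1
  | Seq c1 c2 => csz c1 + csz c2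
  | If _ c0 c1 ce => csz c0 + csz c1 + csz ce + 4
  | While _ c => csz c + 2
  end.

(** Jump targets are absolute, hence the base address [b]. Every branch of [If], the last one
    included, closes with a jump, so that all three have the same overhead. *)
Fixpoint compile (c : cmd) (b : nat) : prog :=
  match c with
  | Skip => [::]
  | CPush i a => [:: Push i a]
  | CPop i => [:: Pop i]
  | COut i => [:: Out i]
  | Seq c1 c2 => compile c1 b ++ compile c2 (b + csz c1)
  | If i c0 c1 ce =>
      let b1 := b.+1 + csz c0 + 1 in
      let be := b1 + csz c1 + 1 in
      let e := be + csz ce + 1 in
      Br i b.+1 b1 be :: compile c0 b.+1 ++ Jmp e :: compile c1 b1
        ++ Jmp e :: compile ce be ++ [:: Jmp e]
  | While i c => Br i b.+1 b.+1 (b + csz c + 2) :: compile c b.+1 ++ [:: Jmp b]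
  end.

Lemma size_compile c b : size (compile c b) = csz c.
Proof.
elim: c b => //= [c1 IH1 c2 IH2|i c0 IH0 c1 IH1 ce IHe|i c IH] b.
- by rewrite size_cat IH1 IH2.
- by rewrite !(size_cat, IH0, IH1, IHe) /= !(size_cat, IH0, IH1, IHe) /=
    size_cat IHe /=; lia.
- by rewrite size_cat IH /=; lia.
Qed.

(* Times are absolute: [t] is the clock before, [t'] after. *)
Inductive ev : cmd -> state -> nat -> state -> nat -> seq (word * nat) -> Prop :=
| ev_skip s t : ev Skip s t s t [::]
| ev_push i b s t : ev (CPush i b) s t (upd s i (b :: s i)) (t + 1) [::]
| ev_pop i s t : ev (CPop i) s t (upd s i (behead (s i))) (t + 1) [::]
| ev_out i s t : ev (COut i) s t s (t + (size (s i)).+1)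
                    [:: (s i, t + (size (s i)).+1)]
| ev_seq c1 c2 s t s1 t1 o1 s2 t2 o2 :
    ev c1 s t s1 t1 o1 -> ev c2 s1 t1 s2 t2 o2 -> ev (c1 ;; c2) s t s2 t2 (o1 ++ o2)
| ev_if i c0 c1 ce s t s' t' o :
    ev (match s i with [::] => ce | b :: _ => if b then c1 else c0 end)
       s (t + 1) s' t' o ->
    ev (If i c0 c1 ce) s t s' (t' + 1) o
| ev_while0 i c s t : s i = [::] -> ev (While i c) s t s (t + 1) [::]
| ev_while1 i c s t s1 t1 o1 s2 t2 o2 :
    s i <> [::] -> ev c s (t + 1) s1 t1 o1 ->
    ev (While i c) s1 (t1 + 1) s2 t2 o2 -> ev (While i c) s t s2 t2 (o1 ++ o2).

Definition code_at (P : prog) b (C : prog) :=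
  forall k, k < size C -> nth Halt P (b + k) = nth Halt C k.

Lemma code_at_cons P b i C :
  code_at P b (i :: C) -> nth Halt P b = i /\ code_at P b.+1 C.
Proof.
move=> H; split; first by have := H 0 isT; rewrite addn0.
by move=> k hk; have := H k.+1 hk; rewrite addnS addSn.
Qed.

Lemma code_at_cat P b C1 C2 :
  code_at P b (C1 ++ C2) -> code_at P b C1 /\ code_at P (b + size C1) C2.
Proof.
move=> H; split=> k hk.
  by have := H k; rewrite size_cat nth_cat hk; apply; lia.
have := H (size C1 + k); rewrite size_cat nth_cat addnA addKn.
rewrite [_ + k < size C1]ltnNge leq_addr; apply; lia.
Qed.

(** The remaining fuel [k'] is arbitrary, so that runs compose without any monotonicity argument on
    fuel. *)
Definition reach P c t c' t' o := exists k, forall k',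
  exec P (k + k') c t = (o ++ (exec P k' c' t').1, (exec P k' c' t').2).

Lemma reach_refl P c t : reach P c t c t [::].
Proof. by exists 0 => k'; rewrite add0n /=; case: exec. Qed.

Lemma reach_trans P c t c1 t1 o1 c2 t2 o2 :
  reach P c t c1 t1 o1 -> reach P c1 t1 c2 t2 o2 -> reach P c t c2 t2 (o1 ++ o2).
Proof.
move=> [k1 H1] [k2 H2]; exists (k1 + k2) => k'.
by rewrite -addnA H1 H2 /= catA.
Qed.

Lemma reach_step P c t c' o d : step P c = Some (c', o, d) ->
  reach P c t c' (t + d) (if o is Some w then [:: (w, t + d)] else [::]).
Proof. by move=> E; exists 1 => k'; rewrite add1n /= E; case: o {E} => //=; case: exec. Qed.

Lemma reach_jmp P b s t e : nth Halt P b = Jmp e ->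
  reach P (Cfg b s) t (Cfg e s) (t + 1) [::].
Proof. by move=> E; apply: (@reach_step _ _ _ _ None); rewrite /step /= E. Qed.

(** By induction on the derivation: each piece of code falls through to the address just after it.
    The clocks agree exactly, since [ev] charges one unit for each branching and each closing
    jump. *)
Lemma compile_correct c s t s' t' o : ev c s t s' t' o ->
  forall P b, code_at P b (compile c b) ->
  reach P (Cfg b s) t (Cfg (b + csz c) s') t' o.
Proof.
elim=> {c s t s' t' o} /=.
- by move=> s t P b _; rewrite addn0; apply: reach_refl.
- move=> i a s t P b /code_at_cons[E _]; rewrite addn1.
  by apply: (@reach_step _ _ _ _ None); rewrite /step /= E.
- move=> i s t P b /code_at_cons[E _]; rewrite addn1.
  by apply: (@reach_step _ _ _ _ None); rewrite /step /= E.
- move=> i s t P b /code_at_cons[E _]; rewrite addn1.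
  by apply: (@reach_step _ _ _ _ (Some _)); rewrite /step /= E.
- move=> c1 c2 s t s1 t1 o1 s2 t2 o2 _ IH1 _ IH2 P b /code_at_cat[H1].
  rewrite size_compile => H2; rewrite addnA.
  by apply: reach_trans (IH1 _ _ H1) (IH2 _ _ H2).
- move=> i c0 c1 ce s t s' t' o _ IH P b /code_at_cons[E].
  move=> /code_at_cat[H0] /code_at_cons[J0] /code_at_cat[H1] /code_at_cons[J1].
  move=> /code_at_cat[He] /code_at_cons[Je _].
  rewrite !size_compile in J0 H1 J1 He Je.
  set e := (X in Jmp X) in J0 J1 Je.
  have Ee : b + (csz c0 + csz c1 + csz ce + 4) = e by rewrite /e; lia.
  have [l [stp]] : exists l,
    step P (Cfg b s) = Some (Cfg l s, None, 1) /\
    reach P (Cfg l s) (t + 1) (Cfg e s') (t' + 1) o.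
    rewrite /step /= E; case Es: (s i) IH => [|[] w] IH.
    + eexists; split; first by [].
      rewrite -[o]cats0; apply: reach_trans (IH P _ _) (reach_jmp _ _ _).
        by move: He; rewrite !addn1 !addSn.
      by move: Je; rewrite !addn1 !addSn.
    + eexists; split; first by [].
      rewrite -[o]cats0; apply: reach_trans (IH P _ _) (reach_jmp _ _ _).
        by move: H1; rewrite !addn1 !addSn.
      by move: J1; rewrite !addn1 !addSn.
    + eexists; split; first by [].
      by rewrite -[o]cats0; apply: reach_trans (IH P _ H0) (reach_jmp _ _ _).
  by rewrite Ee => R; apply: reach_trans (reach_step _ stp) R.
- move=> i c s t Es P b /code_at_cons[E _]; rewrite addnA.
  by apply: (@reach_step _ _ _ _ None); rewrite /step /= E Es.
- move=> i c s t s1 t1 o1 s2 t2 o2 Es _ IH1 _ IH2 P b H.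
  have /code_at_cons[E /code_at_cat[H1 /code_at_cons[J _]]] := H.
  rewrite size_compile in J.
  have stp : step P (Cfg b s) = Some (Cfg b.+1 s, None, 1).
    by rewrite /step /= E; case: (s i) Es => // -[].
  apply: reach_trans (reach_step _ stp) _.
  apply: reach_trans (IH1 _ _ H1) _.
  by apply: reach_trans (reach_jmp _ _ J) _; apply: IH2.
Qed.

Lemma compile_halts c ins s' T o : ev c (init ins).(stk) 0 s' T o ->
  halts_with (compile c 0) ins o T.
Proof.
move=> /compile_correct/(_ (compile c 0) 0); rewrite add0n => -[].
  by move=> k _; rewrite add0n.
(* The final address is past the end of the code, where [nth] returns its default [Halt]; one more
   unit of fuel detects it. *)
move=> k H; exists (k + 1); have -> : init ins = Cfg 0 (init ins).(stk) by [].
by rewrite H /= /step /= nth_default ?size_compile //= cats0.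
Qed.

(** A total-correctness triple for output-free commands. The starting clock is arbitrary, so that
    bounds add up along sequences. *)
Definition qrun c (s : state) T (Q : state -> Prop) :=
  forall t, exists s' t', [/\ ev c s t s' t' [::], t' <= t + T & Q s'].

Lemma q_mono c s T T' (Q Q' : state -> Prop) :
  qrun c s T Q -> T <= T' -> (forall s', Q s' -> Q' s') -> qrun c s T' Q'.
Proof.
move=> H le1 HQ t; have [s' [t' [E le2 q]]] := H t.
by exists s', t'; split; [|lia|apply: HQ].
Qed.

Lemma q_skip s T (Q : state -> Prop) : Q s -> qrun Skip s T Q.
Proof. by move=> q t; exists s, t; split; [constructor|lia|]. Qed.

Lemma q_push i b s T (Q : state -> Prop) :
  Q (upd s i (b :: s i)) -> 0 < T -> qrun (CPush i b) s T Q.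
Proof. by move=> q h t; exists (upd s i (b :: s i)), (t + 1); split; [constructor|lia|]. Qed.

Lemma q_pop i s T (Q : state -> Prop) :
  Q (upd s i (behead (s i))) -> 0 < T -> qrun (CPop i) s T Q.
Proof. by move=> q h t; exists (upd s i (behead (s i))), (t + 1); split; [constructor|lia|]. Qed.

Lemma q_seq T1 T2 c1 c2 s T Q :
  qrun c1 s T1 (fun s1 => qrun c2 s1 T2 Q) -> T1 + T2 <= T -> qrun (c1 ;; c2) s T Q.
Proof.
move=> H h t; have [s1 [t1 [E1 l1 H2]]] := H t.
have [s2 [t2 [E2 l2 q]]] := H2 t1.
by exists s2, t2; split=> //; [apply: (ev_seq E1 E2)|lia].
Qed.

Lemma q_if T1 i c0 c1 ce s T Q :
  qrun (match s i with [::] => ce | b :: _ => if b then c1 else c0 end) s T1 Q ->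
  T1 + 2 <= T -> qrun (If i c0 c1 ce) s T Q.
Proof.
move=> H h t; have [s1 [t1 [E1 l1 q]]] := H (t + 1).
by exists s1, (t1 + 1); split=> //; [apply: ev_if|lia].
Qed.

Lemma q_while0 i c s T (Q : state -> Prop) :
  s i = [::] -> Q s -> 0 < T -> qrun (While i c) s T Q.
Proof. by move=> E q h t; exists s, (t + 1); split; [apply: ev_while0|lia|]. Qed.

Lemma q_while1 T1 T2 i c s T Q : s i <> [::] ->
  qrun c s T1 (fun s1 => qrun (While i c) s1 T2 Q) -> T1 + T2 + 2 <= T ->
  qrun (While i c) s T Q.
Proof.
move=> n H h t; have [s1 [t1 [E1 l1 H2]]] := H (t + 1).
have [s2 [t2 [E2 l2 q]]] := H2 (t1 + 1).
by exists s2, t2; split=> //; [apply: (ev_while1 n E1 E2)|lia].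
Qed.

(** * Moving, copying, encoding and decoding words *)

Ltac upds := let j := fresh "j" in intro j; unfold upd in *;
  repeat match goal with |- context [?x == ?y] => case: (@eqP _ x y) => ? end;
  subst; try by []; try congruence.

Ltac eqs := do ?case: eqP; intros; subst; rewrite ?cats0; try done; try congruence.

Notation TMP := 1.

Definition mv a b := While a (If a (CPush b false) (CPush b true) Skip ;; CPop a).
(** Moving reverses a word; copying passes through [TMP], and the second reversal restores the
    source while building the copy. *)
Definition cp a b := mv a TMP ;;
  While TMP (If TMP (CPush a false ;; CPush b false) (CPush a true ;; CPush b true) Skip
             ;; CPop TMP).
Definition clr a := While a (CPop a).
(* While decoding, [W] serves as the loop flag. *)
Definition dec S W := CPush W true ;;
  While W (If S (CPop S ;; CPop S ;; CPop W)
                (CPop S ;; If S (CPush TMP false) (CPush TMP true) Skip ;; CPop S)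
                (CPop W)) ;;
  mv TMP W.
(** A stack is written from its far end, so the terminator comes first and each letter is pushed
    before its marker [true]. *)
Definition enc W S := mv W TMP ;; CPush S false ;; CPush S false ;;
  While TMP (If TMP (CPush S false) (CPush S true) Skip ;; CPush S true ;; CPop TMP).

Lemma mv_ok a b s T (Q : state -> Prop) : a != b -> 6 * size (s a) + 1 <= T ->
  (forall s', s' =1 upd (upd s b (rev (s a) ++ s b)) a [::] -> Q s') ->
  qrun (mv a b) s T Q.
Proof.
move=> /eqP nab; move Ew: (s a) => w.
elim: w s Ew T => [|x w IH] s Ew T hT HQ.
  by apply: q_while0; [exact: Ew | apply: HQ; upds | lia].
apply: (@q_while1 4 (6 * size w + 1)); [by rewrite Ew| |by move: hT => /=; lia].
apply: (@q_seq 3 1) => //; apply: (@q_if 1) => //; rewrite Ew.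
have -> : (if x then CPush b true else CPush b false) = CPush b x by case: (x).
apply: q_push => //; apply: q_pop => //; apply: IH => //.
  by rewrite /upd eqxx; case: eqP => // _; rewrite Ew.
move=> s' E; apply: HQ => j; rewrite E rev_cons cat_rcons.
by move: j; upds.
Qed.

Lemma clr_ok a s T (Q : state -> Prop) : 3 * size (s a) + 1 <= T ->
  (forall s', s' =1 upd s a [::] -> Q s') -> qrun (clr a) s T Q.
Proof.
move Ew: (s a) => w; elim: w s Ew T => [|x w IH] s Ew T hT HQ.
  by apply: q_while0; [exact: Ew | apply: HQ; upds | lia].
apply: (@q_while1 1 (3 * size w + 1)); [by rewrite Ew| |by move: hT => /=; lia].
apply: q_pop => //; apply: IH => //.
  by rewrite /upd eqxx Ew.
by move=> s' E; apply: HQ => j; rewrite E; move: j; upds.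
Qed.

Lemma cp_ok a b s T (Q : state -> Prop) : a != b -> a != TMP -> b != TMP ->
  s TMP = [::] -> 13 * size (s a) + 2 <= T ->
  (forall s', s' =1 upd s b (s a ++ s b) -> Q s') -> qrun (cp a b) s T Q.
Proof.
move=> /eqP nab /eqP na /eqP nb s1 hT HQ.
apply: (@q_seq (6 * size (s a) + 1) (7 * size (s a) + 1)); last lia.
apply: mv_ok => //; first by apply/eqP.
have main w : forall s T (Q : state -> Prop), s TMP = w -> 7 * size w + 1 <= T ->
  (forall s', s' =1 upd (upd (upd s b (rev w ++ s b)) a (rev w ++ s a)) TMP [::] -> Q s') ->
  qrun (While TMP (If TMP (CPush a false ;; CPush b false) (CPush a true ;; CPush b true) Skip
             ;; CPop TMP)) s T Q.
  elim: w => [|x w IH] {hT HQ s1 T Q} {}s T Q Ew hT HQ.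
    by apply: q_while0; [exact: Ew | apply: HQ; upds | lia].
  apply: (@q_while1 5 (7 * size w + 1)); [by rewrite Ew| |by move: hT => /=; lia].
  apply: (@q_seq 4 1) => //; apply: (@q_if 2) => //; rewrite Ew.
  have -> : (if x then CPush a true ;; CPush b true else CPush a false ;; CPush b false)
     = (CPush a x ;; CPush b x) by case: (x).
  apply: (@q_seq 1 1) => //; apply: q_push => //; apply: q_push => //.
  apply: q_pop => //; apply: IH => //.
    by rewrite /upd; do ?case: eqP => //; rewrite ?Ew //; congruence.
  move=> s' E; apply: HQ => j; rewrite E rev_cons !cat_rcons.
  by move: j; upds.
move=> s' E; apply: (main (rev (s a))) => //.
- by rewrite E s1 cats0 /upd; case: eqP => //; congruence.
- by rewrite size_rev.
move=> s2 E2; apply: HQ => j; rewrite E2 revK /upd !E /upd.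
by eqs.
Qed.

Lemma enc_wordE x w : enc_word (x :: w) = [:: true, x & enc_word w].
Proof. by []. Qed.

Lemma size_enc_word w : size (enc_word w) = 2 * size w + 2.
Proof. by elim: w => // x w IH; rewrite enc_wordE /= IH; lia. Qed.

Lemma enc_ok W S s T (Q : state -> Prop) : W != S -> W != TMP -> S != TMP ->
  s TMP = [::] -> 13 * size (s W) + 4 <= T ->
  (forall s', s' =1 upd (upd s S (enc_word (s W) ++ s S)) W [::] -> Q s') ->
  qrun (enc W S) s T Q.
Proof.
move=> /eqP nWS /eqP nW /eqP nS s1 hT HQ.
apply: (@q_seq (6 * size (s W) + 1) (7 * size (s W) + 3)); last lia.
apply: mv_ok => //; first by apply/eqP.
(* [r] is the suffix already encoded, above the old contents [t]; it starts empty, with only the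
   terminator written. *)
have main w : forall s T r t (Q : state -> Prop), s TMP = w -> s S = enc_word r ++ t ->
  7 * size w + 1 <= T ->
  (forall s', s' =1 upd (upd s S (enc_word (rev w ++ r) ++ t)) TMP [::] -> Q s') ->
  qrun (While TMP (If TMP (CPush S false) (CPush S true) Skip ;; CPush S true ;; CPop TMP))
   s T Q.
  elim: w => [|x w IH] {hT HQ s1 T Q} {}s T r t Q Ew ES hT HQ.
    by apply: q_while0; [exact: Ew | apply: HQ; upds | lia].
  apply: (@q_while1 5 (7 * size w + 1)); [by rewrite Ew| |by move: hT => /=; lia].
  apply: (@q_seq 3 2) => //; apply: (@q_if 1) => //; rewrite Ew.
  have -> : (if x then CPush S true else CPush S false) = CPush S x by case: (x).
  apply: q_push => //; apply: (@q_seq 1 1) => //; apply: q_push => //; apply: q_pop => //.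
  apply: (IH _ _ (x :: r) t) => //.
  - by rewrite /upd; do ?case: eqP => //; rewrite ?Ew //; congruence.
  - by rewrite /upd; do ?case: eqP => //; rewrite ?ES //; congruence.
  move=> s' E; apply: HQ => j; rewrite E rev_cons !cat_rcons.
  by move: j; upds.
move=> s' E; apply: (@q_seq 1 (7 * size (s W) + 2)); last lia.
apply: q_push => //; apply: (@q_seq 1 (7 * size (s W) + 1)); last lia.
apply: q_push => //; apply: (main (rev (s W)) _ _ [::] (s S)).
- by rewrite /upd; do ?case: eqP; rewrite ?E /upd ?s1 ?cats0; do ?case: eqP; congruence.
- by rewrite /upd !eqxx E /upd; eqs.
- by rewrite size_rev.
move=> s2 E2; apply: HQ => j; rewrite E2 revK cats0 /upd !E /upd.
by eqs.
Qed.

Lemma dec_ok S W w r s T (Q : state -> Prop) : W != S -> W != TMP -> S != TMP ->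
  s TMP = [::] -> s W = [::] -> s S = enc_word w ++ r -> 15 * size w + 10 <= T ->
  (forall s', s' =1 upd (upd s S r) W w -> Q s') ->
  qrun (dec S W) s T Q.
Proof.
move=> /eqP nWS /eqP nW /eqP nS s1 sW sS hT HQ.
apply: (@q_seq 1 (15 * size w + 9)); last lia.
apply: q_push => //; apply: (@q_seq (9 * size w + 8) (6 * size w + 1)); last lia.
(* The decoded letters pile up on [TMP] in reverse order; the final [mv] restores it. *)
have main : forall s T (Q : state -> Prop), s S = enc_word w ++ r ->
  s W = [:: true] -> 9 * size w + 8 <= T ->
  (forall s', s' =1 upd (upd (upd s S r) W [::]) TMP (rev w ++ s TMP) -> Q s') ->
  qrun (While W (If S (CPop S ;; CPop S ;; CPop W)
                (CPop S ;; If S (CPush TMP false) (CPush TMP true) Skip ;; CPop S)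
                (CPop W))) s T Q.
  move=> {T Q hT HQ s sS s1 sW}; elim: w => [|x w IH] s T Q sS sW hT HQ.
    apply: (@q_while1 5 1); [by rewrite sW| |by move: hT => /=; lia].
    apply: (@q_if 3) => //; rewrite sS /=.
    apply: (@q_seq 1 2) => //; apply: q_pop => //; apply: (@q_seq 1 1) => //.
    apply: q_pop => //; apply: q_pop => //; apply: q_while0 => //.
      by rewrite /upd; do ?case: eqP; rewrite ?sW //; congruence.
    apply: HQ => j; rewrite /upd !eqxx sS sW.
    by do ?case: eqP; intros; subst; rewrite ?sW ?sS /=; try done; congruence.
  apply: (@q_while1 7 (9 * size w + 8)); [by rewrite sW| |by move: hT => /=; lia].
  apply: (@q_if 5) => //; rewrite sS /=.
  apply: (@q_seq 1 4) => //; apply: q_pop => //; apply: (@q_seq 3 1) => //.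
  apply: (@q_if 1) => //; rewrite {1}/upd eqxx sS /=.
  have -> : (if x then CPush 1 true else CPush 1 false) = CPush 1 x by case: (x).
  apply: q_push => //; apply: q_pop => //; apply: IH => //.
  - by rewrite /upd; do ?case: eqP; rewrite ?sS //; congruence.
  - by rewrite /upd; do ?case: eqP; rewrite ?sW //; congruence.
  move=> s' E; apply: HQ => j; rewrite E rev_cons !cat_rcons.
  by move: j; upds.
apply: main => //.
- by rewrite /upd; do ?case: eqP; rewrite ?sS //; congruence.
- by rewrite /upd eqxx sW.
have t1 s' : s' =1 upd (upd (upd (upd s W (true :: s W)) S r) W [::]) TMP (rev w) ->
   s' TMP = rev w by move=> ->; rewrite /upd eqxx.
rewrite {1}[upd s W _ TMP]/upd.
case: eqP => [?|_]; first by congruence.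
rewrite s1 cats0 => s' E; apply: mv_ok; [by rewrite eq_sym; apply/eqP| |].
  by rewrite (t1 s') // size_rev.
move=> s2 E2; apply: HQ => j; rewrite E2 (t1 s') // revK /upd !E /upd.
by eqs.
Qed.

(** * Simulation of a machine program by a command *)

Definition instr_stk (i : instr) : nat :=
  match i with
  | Push a _ | Pop a | Br a _ _ _ | Out a => a.+1
  | _ => 0
  end.

(* At least 3, so as to cover the stacks holding the inputs. *)
Definition nstk (P : prog) := foldr (fun i m => maxn (instr_stk i) m) 3 P.

Lemma instr_stk_le P l : instr_stk (nth Halt P l) <= nstk P.
Proof.
elim: P l => [|i P IH] [|l] //=; first by rewrite leq_maxl.
by apply: leq_trans (IH l) (leq_maxr _ _).
Qed.

Lemma nstk_ge3 P : 2 < nstk P.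
Proof. by elim: P => //= i P IH; apply: leq_trans IH (leq_maxr _ _). Qed.

(** Hence only the first [nstk P] stacks have to be emptied after a simulation. *)
Lemma step_frame P c c' o d i : step P c = Some (c', o, d) -> nstk P <= i ->
  stk c' i = stk c i.
Proof.
have := instr_stk_le P (pc c); rewrite /step.
case: nth => [a b|a|a l0 l1 le|l|a|] //= Ha [<- _ _] //= Hi; rewrite /upd;
  case: eqP => // E; lia.
Qed.

(** Elapsed time thus bounds the growth of the stacks, and so the cost of emptying them after a
    simulation. *)
Lemma step_size P c c' o d i : step P c = Some (c', o, d) ->
  0 < d /\ size (stk c' i) <= size (stk c i) + d.
Proof.
rewrite /step; case: nth => [a b|a|a l0 l1 le|l|a|] //= [<- _ <-] /=; split=> //;
  rewrite ?leq_addr //.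
- by rewrite /upd; case: eqP => [->|_] /=; lia.
- by rewrite /upd; case: eqP => [->|_] /=; rewrite ?size_behead; lia.
Qed.

Section Simulation.
Variables (P : prog) (f : nat -> nat) (p r : nat) (h : cmd).
Hypothesis f_inj : injective f.
Hypothesis f_fresh : forall i, [/\ f i <> p, f i <> r & f i <> TMP].
Hypothesis pr_fresh : [/\ p <> r, p <> TMP & r <> TMP].

(* Stack [p] holds the program counter of the simulated program, in unary
   and shifted by one; it is empty when the program has stopped. *)
Definition goto l := if l < size P then iter l.+1 (Seq (CPush p true)) Skip else Skip.

(** On an output, the counter is set before [h] runs, so that [h] can stop the simulation by
    emptying [p]. *)
Definition sim_instr k i :=
  match i with
  | Push a b => CPush (f a) b ;; goto k.+1
  | Pop a => CPop (f a) ;; goto k.+1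
  | Br a l0 l1 le => If (f a) (goto l0) (goto l1) (goto le)
  | Jmp l => goto l
  | Out a => cp (f a) r ;; goto k.+1 ;; h
  | Halt => Skip
  end.

(** A walk along the unary counter: each bit removed skips one instruction, and the one at which the
    counter runs out is executed. *)
Fixpoint dispatch k (Q : prog) :=
  match Q with
  | [::] => Skip
  | i :: Q' => If p Skip (CPop p ;; dispatch k.+1 Q') (sim_instr k i)
  end.

Definition sim := While p (CPop p ;; dispatch 0 P).

Definition pcst l := if l < size P then nseq l.+1 true else [::].

Lemma goto_ok l s T (Q : state -> Prop) : s p = [::] -> size P <= T ->
  (forall s', s' =1 upd s p (pcst l) -> Q s') -> qrun (goto l) s T Q.
Proof.
rewrite /goto /pcst; case: ltnP => [hl|_] E hT HQ; last first.
  by apply: q_skip; apply: HQ; upds.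
suff main n : forall s T (Q : state -> Prop), n <= T ->
    (forall s', s' =1 upd s p (nseq n true ++ s p) -> Q s') ->
    qrun (iter n (Seq (CPush p true)) Skip) s T Q.
  by apply: main; [lia|rewrite E cats0].
elim: n => [|n IH] {E hT HQ T Q} {}s T Q hT HQ /=.
  by apply: q_skip; apply: HQ; upds.
apply: (@q_seq 1 n) => //; apply: q_push => //; apply: IH => // s' E.
apply: HQ => j; rewrite E /upd eqxx; case: eqP => // _.
by elim: (n) => //= k ->.
Qed.

Lemma dispatch_ok Q' k l s T (Q : state -> Prop) : s p = nseq l true -> l < size Q' ->
  (forall s', s' =1 upd s p [::] -> qrun (sim_instr (k + l) (nth Halt Q' l)) s' T Q) ->
  qrun (dispatch k Q') s (T + 3 * l + 2) Q.
Proof.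
elim: Q' k l s => //= i Q' IH k [|l] s E hl H.
  apply: (@q_if T); last lia; rewrite E /=.
  by rewrite -[k in sim_instr k]addn0; apply: H; upds.
apply: (@q_if (T + 3 * l + 3)); last lia; rewrite E /=.
apply: (@q_seq 1 (T + 3 * l + 2)); last lia.
apply: q_pop => //; apply: IH => //; first by rewrite /upd eqxx E.
move=> s' E'; rewrite addSnnS; apply: H => j; rewrite E'.
by move: j; upds.
Qed.

Definition visible j := (forall i, j <> f i) /\ j <> p.

Definition sim_rel c (s : state) :=
  s p = pcst (pc c) /\ forall i, s (f i) = stk c i.

Definition sim_const := 5 * size P + 20.

(** Dispatching and resetting the counter cost a multiple of [size P]; copying an output word is
    paid for by the [d] units charged for printing it. Hence a bound linear in [d]. *)
Lemma sim_step c c' o d H s (Q : state -> Prop) :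
  step P c = Some (c', o, d) -> sim_rel c s -> s TMP = [::] ->
  (forall s', sim_rel c' s' -> s' r = odflt [::] o ++ s r ->
     (forall j, visible j -> j <> r -> s' j = s j) ->
     if o is Some _ then qrun h s' H Q else Q s') ->
  qrun (CPop p ;; dispatch 0 P) s ((5 * size P + 18) * d + (if o is Some _ then H else 0)) Q.
Proof.
move=> stp [sp sf] s1 HQ.
have [fpN frN f1N] : [/\ forall i, f i <> p, forall i, f i <> r & forall i, f i <> TMP].
  by split=> i; case: (f_fresh i).
have [nr1 nr2 nr3] := pr_fresh.
have lt : pc c < size P.
  rewrite ltnNge; apply/negP => le; move: stp; rewrite /step nth_default //.
rewrite /pcst lt in sp.
have [dpos _] := step_size 0 stp.
set X := if o is Some _ then H else 0.
apply: (@q_seq 1 ((size P + 14 * d + 3 + X) + 3 * pc c + 2)); last first.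
  by rewrite mulnDl; have : 5 * size P <= 5 * size P * d; [rewrite leq_pmulr|lia].
apply: q_pop => //; apply: dispatch_ok => //; first by rewrite /upd eqxx sp.
move=> s2 E2; rewrite add0n; move: stp; rewrite /step.
have sp2 : s2 p = [::] by rewrite E2 /upd eqxx.
have s21 : s2 TMP = [::] by rewrite E2 /upd; do ?case: eqP.
have sv2 j : j <> p -> s2 j = s j by move=> nj; rewrite E2 /upd; do ?case: eqP.
have sf2 i : s2 (f i) = stk c i by rewrite sv2.
case En: (nth Halt P (pc c)) => [a b|a|a l0 l1 le|l|a|] //= [Ec Eo Ed].
- apply: (@q_seq 1 (size P)); last lia.
  apply: q_push => //; apply: goto_ok; rewrite ?leqnn //.
    by rewrite /upd; case: eqP => // E; case: (fpN a).
  move=> s' E'; subst o; apply: HQ; subst c'.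
  + split; first by rewrite E' /upd eqxx.
    move=> i; rewrite E' /upd /= (inj_eq f_inj) sf2 sf2.
    by case: eqP => // E; case: (fpN i).
  + by rewrite E' /= /upd; case: eqP => [?|_]; [congruence|]; case: eqP => E;
      [case: (frN a)|rewrite sv2 //; congruence].
  + move=> j [vj njp] njr; rewrite E' /upd; case: eqP => // _.
    by case: eqP => [E|_]; [case: (vj a)|rewrite sv2].
- apply: (@q_seq 1 (size P)); last lia.
  apply: q_pop => //; apply: goto_ok; rewrite ?leqnn //.
    by rewrite /upd; case: eqP => // E; case: (fpN a).
  move=> s' E'; subst o; apply: HQ; subst c'.
  + split; first by rewrite E' /upd eqxx.
    move=> i; rewrite E' /upd /= (inj_eq f_inj) sf2 sf2.
    by case: eqP => // E; case: (fpN i).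
  + by rewrite E' /= /upd; case: eqP => [?|_]; [congruence|]; case: eqP => E;
      [case: (frN a)|rewrite sv2 //; congruence].
  + move=> j [vj njp] njr; rewrite E' /upd; case: eqP => // _.
    by case: eqP => [E|_]; [case: (vj a)|rewrite sv2].
- apply: (@q_if (size P)); last lia; rewrite sf2.
  have -> : match stk c a with [::] => goto le | b :: _ => if b then goto l1 else goto l0 end
    = goto (pc c') by rewrite -Ec /=; case: (stk c a) => // -[].
  apply: goto_ok => // s' E'; subst o; apply: HQ; subst c'.
  + split; first by rewrite E' /upd eqxx.
    by move=> i; rewrite E' /upd -sf2; case: eqP => // E; case: (fpN i).
  + by rewrite E' /upd; case: eqP => [?|_]; [congruence|]; rewrite sv2 //; congruence.
  + by move=> j [vj njp] njr; rewrite E' /upd; case: eqP => // _; rewrite sv2.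
- apply: goto_ok => //; first lia.
  move=> s' E'; subst o; apply: HQ; subst c'.
  + split; first by rewrite E' /upd eqxx.
    by move=> i; rewrite E' /upd -sf2; case: eqP => // E; case: (fpN i).
  + by rewrite E' /upd; case: eqP => [?|_]; [congruence|]; rewrite sv2 //; congruence.
  + by move=> j [vj njp] njr; rewrite E' /upd; case: eqP => // _; rewrite sv2.
- apply: (@q_seq (14 * d) (size P + H)); last by rewrite /X -Eo; lia.
  apply: cp_ok => //; try by apply/eqP; rewrite ?sf2; auto.
    by rewrite sf2 -Ed; lia.
  move=> s3 E3; apply: (@q_seq (size P) H) => //.
  apply: goto_ok => //; first by rewrite E3 /upd; case: eqP.
  move=> s' E'; subst o; apply: HQ; subst c'.
  + split; first by rewrite E' /upd eqxx.
    move=> i; rewrite E' /upd; case: eqP => [E|_]; first by case: (fpN i).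
    by rewrite E3 /upd; case: eqP => [E|_]; [case: (frN i)|].
  + rewrite E' /upd; case: eqP => [?|_]; [congruence|].
    by rewrite E3 /upd eqxx sf2 sv2 //; congruence.
  + move=> j [vj njp] njr; rewrite E' /upd; case: eqP => // _.
    by rewrite E3 /upd; case: eqP => // _; rewrite sv2.
Qed.

(** An address outside the program is an empty counter already; an explicit [Halt] is dispatched to
    [Skip] once the counter has been used up. *)
Lemma sim_halt c s t : step P c = None -> sim_rel c s ->
  exists s' t', [/\ ev sim s t s' t' [::], t' <= t + sim_const, s' p = [::] &
     forall j, j <> p -> s' j = s j].
Proof.
move=> stp [sp sf]; rewrite /pcst in sp; case: ltnP sp => [lt|ge] sp; last first.
  exists s, (t + 1); split=> //; first exact: ev_while0.
  by rewrite /sim_const; lia.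
suff: qrun sim s sim_const (fun s' => s' p = [::] /\ forall j, j <> p -> s' j = s j).
  by move=> /(_ t)[s' [t' [E h1 [h2 h3]]]]; exists s', t'.
apply: (@q_while1 (1 + (3 * pc c + 2)) 1); [by rewrite sp| |by rewrite /sim_const; lia].
apply: (@q_seq 1 (3 * pc c + 2)) => //; apply: q_pop => //.
rewrite -[3 * _ + 2]add0n addnA.
apply: dispatch_ok => //; first by rewrite /upd eqxx sp.
move=> s' E'; move: stp; rewrite add0n /step; case: nth => //= _.
apply: q_skip; apply: q_while0 => //; rewrite ?E' /upd ?eqxx //.
by split=> // j nj; rewrite E' /upd; do ?case: eqP.
Qed.

(** By induction on the fuel of the simulated run. [I] is an invariant indexed by the outputs
    already handled, and [A] describes an abort on the output [w]. The clock advances by [sim_const]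
    per simulated unit of time and by [H] per handled output; an aborted run is charged only up to
    the output that stopped it. *)
Lemma sim_run H (I : seq word -> state -> Prop) (A : seq word -> word -> state -> Prop)
    (all_outs : seq word) :
  (forall done s s', (forall j, visible j -> s j = s' j) -> I done s -> I done s') ->
  (forall done s, I done s -> s TMP = [::]) ->
  (forall done w rest s c s0, all_outs = done ++ w :: rest -> I done s0 ->
     (forall j, visible j -> j <> r -> s j = s0 j) -> s r = w ++ s0 r ->
     sim_rel c s ->
     qrun h s H (fun s' => (forall i, s' (f i) = stk c i) /\
       (s' p = pcst (pc c) /\ I (rcons done w) s' \/ s' p = [::] /\ A done w s'))) ->
  forall k c t0 outs T, exec P k c t0 = (outs, Some T) ->
  forall done s t, sim_rel c s -> I done s -> all_outs = done ++ map fst outs ->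
  exists s' t' c', [/\ ev sim s t s' t' [::], s' p = [::],
    forall i, s' (f i) = stk c' i, forall i, nstk P <= i -> stk c' i = stk c i &
    ([/\ I all_outs s',
         t' + sim_const * t0 <= t + sim_const * T + H * size outs + sim_const &
         forall i, size (stk c' i) + t0 <= size (stk c i) + T]
     \/ exists o1 w tw o2, [/\ outs = o1 ++ (w, tw) :: o2,
         A (done ++ map fst o1) w s',
         t' + sim_const * t0 <= t + sim_const * tw + H * (size o1).+1 + sim_const &
         forall i, size (stk c' i) + t0 <= size (stk c i) + tw])].
Proof.
move=> I_ext I_tmp Hh; elim=> [|k IH] c t0 outs T //=.
case stp: (step P c) => [[[c1 o] d]|]; last first.
  move=> [<- <-] done s t R Id; rewrite cats0 => ->.
  have [s' [t' [E le Ep Ej]]] := sim_halt t stp R.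
  exists s', t', c; split=> //; first by move=> i; rewrite Ej ?R.2 //; case: (f_fresh i).
  left; split=> //; last lia.
  by apply: I_ext Id => j [_ nj]; rewrite Ej.
move=> Ex done s t R Id Eall.
have [dpos _] := step_size 0 stp.
have R1 : s p <> [::].
  rewrite R.1 /pcst; case: ltnP => // le; move: stp; rewrite /step nth_default //.
have [rn1 rn2 rn3] := pr_fresh.
have stf i : nstk P <= i -> stk c1 i = stk c i by apply: step_frame stp.
have sts i := (step_size i stp).2.
(* [sim_const] exceeds the rate of [sim_step] by two, which pays for the loop test and the jump
   back. *)
have le_step t1 X : t1 <= t + 1 + ((5 * size P + 18) * d + X) ->
    t1 + 1 <= t + sim_const * d + X.
  have -> : sim_const * d = (5 * size P + 18) * d + 2 * d.
    by rewrite /sim_const -mulnDl; congr muln; lia.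
  lia.
have C2 : 2 <= sim_const by rewrite /sim_const; lia.
case: o stp Ex => [w|] stp.
- case Er: (exec P k c1 (t0 + d)) => [outs1 oT1] /= [Eo ET]; subst outs oT1.
  have: qrun (CPop p ;; dispatch 0 P) s ((5 * size P + 18) * d + H)
    (fun s' => (forall i, s' (f i) = stk c1 i) /\
       (s' p = pcst (pc c1) /\ I (rcons done w) s' \/ s' p = [::] /\ A done w s')).
    apply: (sim_step stp) => //; first exact: I_tmp Id.
    move=> s' R' Er' Ej; apply: (Hh done w (map fst outs1) _ _ s) => //.
  move=> /(_ (t + 1))[s1 [t1 [E1 /le_step le1 [Hf [[Ep Id1]|[Ep HA]]]]]].
  + have [|s' [t' [c' [E' Ep' Ef' Es' HH]]]] :=
      IH _ _ _ _ Er (rcons done w) s1 (t1 + 1) (conj Ep Hf) Id1.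
      by rewrite cat_rcons.
    exists s', t', c'; split=> //.
    * exact: (ev_while1 R1 E1 E').
    * by move=> i hi; rewrite Es' ?stf.
    case: HH => [[h1 h2 h3]|[o1 [w1 [tw [o2 [h1 h2 h3 h4]]]]]]; [left|right].
      split=> // [|i]; last by have := h3 i; have := sts i; lia.
      by rewrite /= mulnS; move: h2; rewrite mulnDr; lia.
    exists ((w, t0 + d) :: o1), w1, tw, o2; split=> //.
    * by rewrite h1.
    * by rewrite /= -cat_rcons.
    * by rewrite /= mulnS; move: h3; rewrite mulnDr; lia.
    * by move=> i; have := h4 i; have := sts i; lia.
  + exists s1, (t1 + 1 + 1), c1; split=> //.
      by apply: (ev_while1 R1 E1); apply: ev_while0.
    right; exists [::], w, (t0 + d), outs1; split=> //.
    * by rewrite cats0.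
    * by rewrite /= mulnDr muln1; lia.
    * by move=> i; have := sts i; lia.
- move=> Er.
  have: qrun (CPop p ;; dispatch 0 P) s ((5 * size P + 18) * d + 0)
    (fun s' => sim_rel c1 s' /\ I done s').
    apply: (@sim_step _ _ _ _ 0 _ _ stp) => //; first exact: I_tmp Id.
    move=> s' R' Er' Ej; split=> //; apply: I_ext Id => j vj.
    by case: (eqVneq j r) => [->|/eqP nj]; [rewrite Er'|rewrite Ej].
  move=> /(_ (t + 1))[s1 [t1 [E1 /le_step le1 [R' Id1]]]].
  have [s' [t' [c' [E' Ep' Ef' Es' HH]]]] := IH _ _ _ _ Er done s1 (t1 + 1) R' Id1 Eall.
  exists s', t', c'; split=> //.
  * exact: (ev_while1 R1 E1 E').
  * by move=> i hi; rewrite Es' ?stf.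
  case: HH => [[h1 h2 h3]|[o1 [w1 [tw [o2 [h1 h2 h3 h4]]]]]]; [left|right].
    by split=> // [|i]; [move: h2; rewrite mulnDr; lia|have := h3 i; have := sts i; lia].
  exists o1, w1, tw, o2; split=> //; first by move: h3; rewrite mulnDr; lia.
  by move=> i; have := h4 i; have := sts i; lia.
Qed.

End Simulation.

(** * Registers and subroutine calls *)

Fixpoint clears (f : nat -> nat) n :=
  if n is n'.+1 then clears f n' ;; clr (f n') else Skip.

Lemma clears_ok f n m s T (Q : state -> Prop) : injective f ->
  (forall i, size (s (f i)) <= m) -> n * (3 * m + 1) <= T ->
  (forall s', (forall i, i < n -> s' (f i) = [::]) ->
     (forall i, n <= i -> s' (f i) = s (f i)) ->
     (forall j, (forall i, j <> f i) -> s' j = s j) -> Q s') ->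
  qrun (clears f n) s T Q.
Proof.
move=> fi hm; elim: n T Q => [|n IH] T Q hT HQ; first by apply: q_skip; apply: HQ.
apply: (@q_seq (n * (3 * m + 1)) (3 * m + 1)); last by move: hT; rewrite mulSn; lia.
apply: IH => // s1 h1 h2 h3; apply: clr_ok => [|s2 E2].
  by rewrite h2 //; have := hm n; lia.
apply: HQ => [i hi|i hi|j hj]; rewrite E2 /upd ?(inj_eq fi).
- by case: eqP => // ?; apply: h1; lia.
- by case: eqP => ?; [lia|apply: h2; lia].
- by case: eqP => [E|_]; [case: (hj n)|apply: h3].
Qed.

(* [rX] holds the input, [rL] the list of answers, [rK] the set under
   construction; [rL1] and [rL2] are working copies of [rL], [rJ] is an element
   of [rL1] or [rL2] and [rK2] a working copy of [rK]; [rV], [rU], [rW] hold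
   nodes and [rR] the output of a subroutine; [rG] (an answer is ready), [rN]
   (the set is new), [rD], [rQ] are flags; [rPA] and [rPE] are the program
   counters of the simulated programs. *)
Notation rX := 0.  Notation rL := 2.  Notation rL1 := 3. Notation rL2 := 4.
Notation rJ := 5.  Notation rK := 6.  Notation rK2 := 7. Notation rV := 8.
Notation rU := 9.  Notation rW := 10. Notation rR := 11. Notation rG := 12.
Notation rN := 13. Notation rD := 14. Notation rQ := 15. Notation rPA := 16.
Notation rPE := 17.

(* Stacks of the simulated node enumerator, and of the two other simulated
   algorithms, which never run at the same time. *)
Definition fA i := 18 + i.*2.
Definition fE i := 19 + i.*2.

Lemma fA_inj : injective fA. Proof. by rewrite /fA => i j; lia. Qed.
Lemma fE_inj : injective fE. Proof. by rewrite /fE => i j; lia. Qed.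

(** With the registers as an explicit list, the effect of a command is computed by [set_nth]. The
    stacks [a] of the node enumerator are a parameter because its simulation may be in progress;
    those of the other algorithms are empty between calls. *)
Definition regs_are (a : state) (r : seq word) (s : state) :=
  [/\ forall i, i < 18 -> s i = nth [::] r i,
      forall i, s (fA i) = a i & forall i, s (fE i) = [::]].

Definition trip c T r r' := forall a s, regs_are a r s -> qrun c s T (regs_are a r').

Lemma regs_ext a r s s' : regs_are a r s -> s' =1 s -> regs_are a r s'.
Proof. by case=> h1 h2 h3 E; split=> i *; rewrite E; auto. Qed.

Lemma regs_upd a r s i w : i < 18 -> regs_are a r s ->
  regs_are a (set_nth [::] r i w) (upd s i w).
Proof.
move=> hi [h1 h2 h3]; split=> j; rewrite /upd.
- by rewrite nth_set_nth /=; case: eqP => // _; apply: h1.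
- by case: eqP => // E; move: hi; rewrite -E /fA; lia.
- by case: eqP => // E; move: hi; rewrite -E /fE; lia.
Qed.

Lemma trip_le T c T' r r' : trip c T r r' -> T <= T' -> trip c T' r r'.
Proof. by move=> H le a s R; apply: q_mono (H a s R) le _. Qed.

Lemma trip_post r1 c T r r' : trip c T r r1 -> r1 = r' -> trip c T r r'.
Proof. by move=> H <-. Qed.

Lemma trip_seq c1 c2 T1 T2 r r1 r2 :
  trip c1 T1 r r1 -> trip c2 T2 r1 r2 -> trip (c1 ;; c2) (T1 + T2) r r2.
Proof.
move=> H1 H2 a s R; apply: (@q_seq T1 T2) => //.
by apply: q_mono (H1 a s R) _ _ => // s1; apply: H2.
Qed.

Lemma trip_skip r : trip Skip 0 r r.
Proof. by move=> a s R; apply: q_skip. Qed.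

Lemma trip_push i b r : i < 18 ->
  trip (CPush i b) 1 r (set_nth [::] r i (b :: nth [::] r i)).
Proof.
by move=> hi a s R; apply: q_push => //; have [h1 _ _] := R; rewrite -h1 //; apply: regs_upd.
Qed.

Lemma trip_pop i r : i < 18 ->
  trip (CPop i) 1 r (set_nth [::] r i (behead (nth [::] r i))).
Proof.
by move=> hi a s R; apply: q_pop => //; have [h1 _ _] := R; rewrite -h1 //; apply: regs_upd.
Qed.

Lemma trip_if i c0 c1 ce T r r' : i < 18 ->
  trip (match nth [::] r i with [::] => ce | b :: _ => if b then c1 else c0 end) T r r' ->
  trip (If i c0 c1 ce) (T + 2) r r'.
Proof.
move=> hi H a s R; apply: (@q_if T) => //; have [h1 _ _] := R; rewrite h1 //; exact: H.
Qed.

Lemma trip_while0 i c r : i < 18 -> nth [::] r i = [::] -> trip (While i c) 1 r r.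
Proof. by move=> hi E a s R; apply: q_while0 => //; have [-> ] := R. Qed.

Lemma trip_while1 i c T1 T2 r r1 r2 : i < 18 -> nth [::] r i <> [::] ->
  trip c T1 r r1 -> trip (While i c) T2 r1 r2 -> trip (While i c) (T1 + T2 + 2) r r2.
Proof.
move=> hi E H1 H2 a s R; apply: (@q_while1 T1 T2) => //; first by have [-> ] := R.
by apply: q_mono (H1 a s R) _ _ => // s1; apply: H2.
Qed.

Lemma enc_list_cons w ws : enc_list (w :: ws) = enc_word w ++ enc_list ws.
Proof. by []. Qed.

Lemma enc_list_cons_neq0 w ws : enc_list (w :: ws) <> [::].
Proof. by case: w. Qed.

(** The rule for loops that consume an encoded list: [St done rest] gives the registers once [done]
    is treated. The loop test is right because only the empty list has an empty encoding. *)
Lemma trip_each X (e : X -> word) S body T (St : seq X -> seq X -> seq word) all :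
  S < 18 ->
  (forall done rest, nth [::] (St done rest) S = enc_list (map e rest)) ->
  (forall done w rest, all = done ++ w :: rest ->
     trip body T (St done (w :: rest)) (St (rcons done w) rest)) ->
  trip (While S body) ((T + 2) * size all + 1) (St [::] all) (St all [::]).
Proof.
move=> hS HS Hb.
suff main rest done : all = done ++ rest ->
    trip (While S body) ((T + 2) * size rest + 1) (St done rest) (St all [::]) by apply: main.
elim: rest done => [|w rest IH] done E.
  rewrite muln0; move: E; rewrite cats0 => <-.
  by apply: trip_while0 => //; rewrite HS.
have := trip_while1 hS _ (Hb _ _ _ E) (IH (rcons done w) _).
rewrite HS cat_rcons => /(_ (@enc_list_cons_neq0 _ _) E) H.
by apply: trip_le H _; rewrite /= mulnS; lia.
Qed.

Section Macros.
Variable M : nat.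
(* A common bound on the cost of the macros, for stacks of size at most [M + 1]. *)
Definition mcost := 15 * M.+1 + 10.

Lemma trip_clr a r : a < 18 -> size (nth [::] r a) <= M.+1 ->
  trip (clr a) mcost r (set_nth [::] r a [::]).
Proof.
move=> ha hm x s R; have [h1 h2 h3] := R.
apply: clr_ok => //; first by rewrite h1 // /mcost; lia.
by move=> s' E; apply: regs_ext _ E; apply: regs_upd.
Qed.

Lemma trip_cp a b r : a != b -> a != TMP -> b != TMP -> a < 18 -> b < 18 ->
  nth [::] r TMP = [::] -> size (nth [::] r a) <= M.+1 ->
  trip (cp a b) mcost r (set_nth [::] r b (nth [::] r a ++ nth [::] r b)).
Proof.
move=> nab na nb ha hb ht hm x s R; have [h1 h2 h3] := R.
apply: cp_ok => //; [by rewrite h1|by rewrite h1 // /mcost; lia|].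
by move=> s' E; apply: regs_ext _ E; rewrite !h1 //; apply: regs_upd.
Qed.

Lemma trip_enc W S r : W != S -> W != TMP -> S != TMP -> W < 18 -> S < 18 ->
  nth [::] r TMP = [::] -> size (nth [::] r W) <= M.+1 ->
  trip (enc W S) mcost r
   (set_nth [::] (set_nth [::] r S (enc_word (nth [::] r W) ++ nth [::] r S)) W [::]).
Proof.
move=> nab na nb ha hb ht hm x s R; have [h1 h2 h3] := R.
apply: enc_ok => //; [by rewrite h1|by rewrite h1 // /mcost; lia|].
by move=> s' E; apply: regs_ext _ E; rewrite !h1 //; do 2!(apply: regs_upd => //).
Qed.

Lemma trip_dec S W w t r : W != S -> W != TMP -> S != TMP -> W < 18 -> S < 18 ->
  nth [::] r TMP = [::] -> nth [::] r W = [::] -> nth [::] r S = enc_word w ++ t ->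
  size w <= M.+1 ->
  trip (dec S W) mcost r (set_nth [::] (set_nth [::] r S t) W w).
Proof.
move=> nab na nb ha hb ht hw hs hm x s R; have [h1 h2 h3] := R.
apply: (@dec_ok _ _ w t) => //; rewrite ?h1 //; first by rewrite /mcost; lia.
by move=> s' E; apply: regs_ext _ E; do 2!(apply: regs_upd => //).
Qed.
End Macros.

Definition call P := goto P rPE 0 ;; sim P fE rPE rR Skip ;; clears fE (nstk P).

Definition call_cost P m t :=
  size P + (sim_const P * t.+1 + nstk P * (3 * (m + t) + 1)).

(** An instance of [sim_run] with the trivial handler, which never aborts: outputs accumulate on
    [rR], the latest on top. Stacks end with size at most [m + t], whence the cost of emptying
    them. *)
Lemma call_ok P ins outs T0 m t s (Q : state -> Prop) : halts_with P ins outs T0 ->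
  size ins <= 3 -> (forall w, w \in ins -> size w <= m) -> T0 <= t ->
  s rPE = [::] -> s TMP = [::] -> (forall i, s (fE i) = nth [::] ins i) ->
  (forall s', s' rR = flatten (rev (map fst outs)) ++ s rR ->
     (forall i, s' (fE i) = [::]) ->
     (forall j, j <> rR -> (forall i, j <> fE i) -> s' j = s j) -> Q s') ->
  qrun (call P) s (call_cost P m t) Q.
Proof.
move=> [k Ex] hi hm ht sp s1 sf HQ.
apply: (@q_seq (size P) (sim_const P * t.+1 + nstk P * (3 * (m + t) + 1))) => //.
apply: goto_ok => // s2 E2.
apply: (@q_seq (sim_const P * t.+1) (nstk P * (3 * (m + t) + 1))) => //.
have sf2 i : s2 (fE i) = nth [::] ins i.
  by rewrite E2 /upd sf; case: eqP => // E; exfalso; move: E; rewrite /fE; lia.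
have R2 : sim_rel P fE rPE (init ins) s2.
  by split=> //; rewrite E2 /upd eqxx.
pose I done (s' : state) := s' rR = flatten (rev done) ++ s rR /\
  forall j, j <> rR -> j <> rPE -> (forall i, j <> fE i) -> s' j = s j.
have fr1 : forall i, [/\ fE i <> rPE, fE i <> rR & fE i <> TMP].
  by move=> i; split; rewrite /fE; lia.
have fr2 : [/\ rPE <> rR, rPE <> TMP & rR <> TMP] by [].
have Iext done sa sb : (forall j, visible fE rPE j -> sa j = sb j) -> I done sa -> I done sb.
  move=> E [h1 h2]; split; last by move=> j *; rewrite -E ?h2.
  by rewrite -E // /visible /fE; split=> // i; lia.
have Itmp done sa : I done sa -> sa TMP = [::].
  by move=> [_ ->] //; rewrite E2.
have Ih done w rest sa c s0 : map fst outs = done ++ w :: rest -> I done s0 ->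
     (forall j, visible fE rPE j -> j <> rR -> sa j = s0 j) -> sa rR = w ++ s0 rR ->
     sim_rel P fE rPE c sa ->
     qrun Skip sa 0 (fun s' => (forall i, s' (fE i) = stk c i) /\
       (s' rPE = pcst P (pc c) /\ I (rcons done w) s' \/ s' rPE = [::] /\ False)).
  move=> _ [h1 h2] Ej Er [Ra Rb]; apply: q_skip; split=> //; left; split=> //.
  split; first by rewrite Er h1 rev_rcons /= catA.
  by move=> j n1 n2 n3; rewrite Ej ?h2.
have I0 : I [::] s2.
  by split=> [|j n1 n2 _]; rewrite E2 /upd //; case: eqP.
have main : qrun (sim P fE rPE rR Skip) s2 (sim_const P * t.+1) (fun s3 =>
    [/\ I (map fst outs) s3, s3 rPE = [::], forall i, nstk P <= i -> s3 (fE i) = [::] &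
        forall i, size (s3 (fE i)) <= m + t]).
  move=> t1.
  have [s3 [t3 [c' [E p3 f3 n3 HH]]]] := @sim_run P fE rPE rR Skip fE_inj fr1
    fr2 0 I (fun _ _ _ => False) (map fst outs) Iext Itmp Ih k
    (init ins) 0 outs T0 Ex [::] s2 t1 R2 I0 erefl.
  exists s3, t3; case: HH => [[h1 h2 h3]|[? [? [? [? []]]]]] //.
  split=> //; first by rewrite mulnS; have := leq_mul (leqnn (sim_const P)) ht; lia.
  split=> // [i hni|i].
    by rewrite f3 n3 //= nth_default //; apply: leq_trans hi (leq_trans (nstk_ge3 P) hni).
  rewrite f3; have := h3 i; rewrite /= addn0 => h; apply: leq_trans h _.
  apply: leq_add => //; case: (ltnP i (size ins)) => hh; last by rewrite nth_default.
  by apply: hm; rewrite mem_nth.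
apply: q_mono main _ _ => // s3 [[h1 h2] h3 h4 h5].
apply: (clears_ok fE_inj h5) => // s4 g1 g2 g3; apply: HQ.
- by rewrite g3 ?h1 ?E2 /upd //= /fE => i; lia.
- by move=> i; case: (ltnP i (nstk P)) => hni; [apply: g1|rewrite g2 ?h4].
- move=> j n1 n2; rewrite g3 //; case: (eqVneq j rPE) => [->|/eqP nj]; first by rewrite h3 sp.
  by rewrite h2 // E2 /upd; case: eqP.
Qed.

Lemma lt18_fE j i : j < 18 -> j <> fE i.
Proof. by rewrite /fE; lia. Qed.

Fixpoint loads k (args : seq nat) :=
  if args is a :: args' then cp a (fE k) ;; loads k.+1 args' else Skip.

Lemma loads_ok M k args s T (Q : state -> Prop) :
  all (fun a => (a < 18) && (a != TMP)) args -> s TMP = [::] ->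
  (forall i, k <= i -> s (fE i) = [::]) -> (forall a, a \in args -> size (s a) <= M.+1) ->
  size args * mcost M <= T ->
  (forall s', (forall j, (forall i, j <> fE i) -> s' j = s j) ->
     (forall i, s' (fE i) = if i < k then s (fE i) else nth [::] (map s args) (i - k)) ->
     Q s') -> qrun (loads k args) s T Q.
Proof.
elim: args k s T => [|a args IH] k s T /=.
  move=> _ _ h0 _ _ HQ; apply: q_skip; apply: HQ => // i.
  by case: ltnP => // /h0 ->; rewrite nth_nil.
move=> /andP[/andP[ha na] hall] s1 h0 hm hT HQ.
have naE i : a != fE i by apply/eqP; rewrite /fE; lia.
apply: (@q_seq (mcost M) (size args * mcost M)) => //.
apply: cp_ok => //; first by have := hm a (mem_head _ _); rewrite /mcost; lia.
move=> s2 E2.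
have s2N j : (forall i, j <> fE i) -> s2 j = s j.
  by move=> hj; rewrite E2 /upd; case: eqP => // /hj.
have s2a b : b \in args -> s2 b = s b.
  by move=> hb; apply: s2N => i; apply: lt18_fE; have /andP[] := allP hall _ hb.
apply: IH => //.
- by rewrite E2.
- by move=> i hi; rewrite E2 /upd (inj_eq fE_inj) gtn_eqF // h0 // ltnW.
- by move=> b hb; rewrite s2a // hm // inE hb orbT.
move=> s3 h3 h4; apply: HQ => [j hj|i]; first by rewrite h3 ?s2N.
rewrite h4 ltnS; case: ltngtP => hi.
- by rewrite E2 /upd (inj_eq fE_inj) ltn_eqF // .
- rewrite -[i - k]prednK ?subn_gt0 // -subnS /=; congr nth.
  by apply/eq_in_map.
- by rewrite hi subnn /= E2 /upd eqxx h0 // cats0.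
Qed.

Lemma trip_call M P args t r outs T0 :
  halts_with P (map (nth [::] r) args) outs T0 -> T0 <= t -> size args <= 3 ->
  all (fun a => (a < 18) && (a != TMP)) args ->
  nth [::] r TMP = [::] -> nth [::] r rPE = [::] ->
  (forall a, a \in args -> size (nth [::] r a) <= M.+1) ->
  trip (loads 0 args ;; call P) (3 * mcost M + call_cost P M.+1 t) r
    (set_nth [::] r rR (flatten (rev (map fst outs)) ++ nth [::] r rR)).
Proof.
move=> Hh ht h3 hall r1 rE hm a s R; have [g1 g2 g3] := R.
have sE b : b \in args -> s b = nth [::] r b.
  by move=> hb; apply: g1; have /andP[] := allP hall _ hb.
apply: (@q_seq (3 * mcost M) (call_cost P M.+1 t)) => //.
apply: (@loads_ok M 0) => //; rewrite ?g1 //.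
  by move=> b hb; rewrite sE ?hm.
  by rewrite leq_mul2r h3 orbT.
move=> s2 h2 k2.
apply: (call_ok Hh) => //.
- by rewrite size_map.
- by move=> w /mapP[b hb ->]; apply: hm.
- by rewrite h2 ?g1 // /fE => i; lia.
- by rewrite h2 ?g1 // /fE => i; lia.
- by move=> i; rewrite k2 /= subn0; congr nth; apply/eq_in_map.
move=> s3 k3 k4 k5; split=> //.
- move=> i hi; rewrite nth_set_nth /=; case: eqP => [->|ni].
    by rewrite k3 h2 ?g1 // /fE => j; lia.
  by rewrite k5 ?h2 ?g1 // => j; rewrite /fE; lia.
- by move=> i; rewrite k5 ?h2 ?g2 // => *; rewrite /fA /fE; lia.
Qed.

(** * The search for a new answer *)

Section Subroutines.
Variables (x : word) (g : graph) (AE B : prog) (M tE tB : nat).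
Hypothesis size_x : size x <= M.
Hypothesis size_v : forall v, v \in verts g -> size v <= M.
Hypothesis size_s : forall s : seq word, uniq s -> indep g s ->
  size s <= M /\ size (enc_list s) <= M.
Hypothesis AE_ok : forall u v, u \in verts g -> v \in verts g ->
  exists outs T, halts_with AE [:: x; u; v] outs T /\
    map fst outs = [:: [:: adj g u v]] /\ T <= tE.
Hypothesis B_ok : forall s : seq word, uniq s -> indep g s ->
  exists outs T, halts_with B [:: x; enc_list s] outs T /\ T <= tB /\
    exists o, map fst outs = [:: o] /\
      ((o = [:: false] /\ maximal_indep g s) \/
       (exists v, o = true :: v /\ v \in verts g /\ v \notin s /\ indep g (v :: s))).

Notation rg l l1 l2 j k k2 v u w r go nw d q pa :=
  [:: x; [::]; l; l1; l2; j; k; k2; v; u; w; r; go; nw; d; q; pa; [::]].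

Notation mc := (mcost M).

(** * Adjacency tests, extension, filtering and comparison of sets *)

Definition adjc := loads 0 [:: rX; rU; rW] ;; call AE.
Definition cost_adj := 3 * mc + call_cost AE M.+1 tE.

Lemma adjc_ok l l1 l2 j k k2 v u w go nw d q pa : u \in verts g -> w \in verts g ->
  trip adjc cost_adj (rg l l1 l2 j k k2 v u w [::] go nw d q pa)
                     (rg l l1 l2 j k k2 v u w [:: adj g u w] go nw d q pa).
Proof.
move=> hu hw; have [outs [T0 [H [E le]]]] := AE_ok hu hw.
eapply trip_post; first apply: (@trip_call M AE [:: rX; rU; rW] tE _ outs T0 _ le) => //.
  move=> a; rewrite !inE => /or3P[] /eqP -> /=; apply: leqW => //; exact: size_v.
by rewrite E.
Qed.

Definition ext := CPush rQ true ;;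
  While rQ ((loads 0 [:: rX; rK] ;; call B) ;;
    If rR (clr rR ;; CPop rQ) (CPop rR ;; enc rR rK) Skip).

Definition cost_extB := 3 * mc + call_cost B M.+1 tB + (mc + 3) + 2.
Definition cost_ext := cost_extB * M.+1 + 2.

(** Every round but the last adds a node to an independent set, whose size never exceeds [M]; the
    induction is on the room left. *)
Lemma ext_ok (s : seq word) l l1 l2 j k2 v u w go nw d pa : uniq s -> indep g s ->
  exists s' : seq word, [/\ uniq s', maximal_indep g s', {subset s <= s'} &
  trip ext cost_ext (rg l l1 l2 j (enc_list s) k2 v u w [::] go nw d [::] pa)
                    (rg l l1 l2 j (enc_list s') k2 v u w [::] go nw d [::] pa)].
Proof.
move=> us is_.
suff [s' [us' ms' ss' H]] : exists s' : seq word,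
  [/\ uniq s', maximal_indep g s', {subset s <= s'} &
  trip (While rQ ((loads 0 [:: rX; rK] ;; call B) ;;
    If rR (clr rR ;; CPop rQ) (CPop rR ;; enc rR rK) Skip))
     (cost_extB * (M.+1 - size s) + 1)
     (rg l l1 l2 j (enc_list s) k2 v u w [::] go nw d [:: true] pa)
     (rg l l1 l2 j (enc_list s') k2 v u w [::] go nw d [::] pa)].
  exists s'; split=> //; eapply trip_le; first by eapply trip_seq; [exact: trip_push|exact: H].
  have : cost_extB * (M.+1 - size s) <= cost_extB * M.+1 by rewrite leq_mul2l leq_subr orbT.
  rewrite /cost_ext; lia.
have [n Hn] : exists n, M - size s = n by eexists.
elim: n s us is_ Hn => [|n IH] s us is_ Hn;
  have [outs [T0 [H [le [o [Eo Ho]]]]]] := B_ok us is_; have [lM lM2] := size_s us is_.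
all: have Hcall : trip (loads 0 [:: rX; rK] ;; call B) (3 * mc + call_cost B M.+1 tB)
      (rg l l1 l2 j (enc_list s) k2 v u w [::] go nw d [:: true] pa)
      (rg l l1 l2 j (enc_list s) k2 v u w o go nw d [:: true] pa)
  by (eapply trip_post; first apply: (@trip_call M B [:: rX; rK] tB _ outs T0 _ le) => //;
   [move=> a; rewrite !inE => /orP[] /eqP -> /=; exact: leqW|
    rewrite Eo /= !cats0]).
all: case: Ho => [[Eo2 mx]|[z [Eo2 [zv [zs iz]]]]]; subst o.
1,3: exists s; split=> //; eapply trip_le; [
  eapply trip_while1; [by []|by []| |by apply: trip_while0];
  eapply trip_seq; [exact: Hcall|];
  eapply trip_if => //=; eapply trip_seq; [by apply: (@trip_clr M)|exact: trip_pop]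
  | rewrite subSn // mulnS /cost_extB; lia].
(* No room is left, so a further node would give an independent set with more than [M] members. *)
- by have := (size_s (s := z :: s)); rewrite /= zs us => /(_ isT iz)[/= hz _]; move: Hn hz; lia.
- have uz : uniq (z :: s) by rewrite /= zs.
  have [lz lz2] := size_s uz iz; rewrite /= in lz.
  have [|s' [us' ms' ss' H']] := IH (z :: s) uz iz; first by move=> /=; lia.
  exists s'; split=> //; first by move=> y hy; apply: ss'; rewrite inE hy orbT.
  eapply trip_le.
    eapply trip_while1 => //; last exact: H'.
    eapply trip_seq; first exact: Hcall.
    eapply trip_if => //; rewrite /=.
    eapply trip_seq; first exact: trip_pop.
    rewrite /=; eapply trip_post; first apply: (@trip_enc M) => //=.
      by rewrite leqW // size_v.
    by [].
  rewrite /= subSS (subSn lM) mulnS /cost_extB; clear; lia.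
Qed.

Lemma size_v1 v : v \in verts g -> size v <= M.+1.
Proof. by move=> /size_v; apply: leqW. Qed.

Definition filterc := While rJ (dec rJ rU ;; cp rV rW ;; adjc ;;
  If rR (enc rU rK) (clr rU ;; clr rD ;; CPush rD true) Skip ;; clr rR ;; clr rW).
Definition cost_filter := (6 * mc + 3 + cost_adj + 2) * M + 1.

Lemma indep_verts s u : indep g s -> u \in s -> u \in verts g.
Proof. by case/andP=> /allP h _ /h. Qed.

Definition bit (b : bool) : word := if b then [:: true] else [::].

Lemma size_bit b : size (bit b) <= M.+1. Proof. by case: b. Qed.

Lemma filterc_ok s v l l1 l2 k2 go nw q pa : uniq s -> indep g s -> v \in verts g ->
  trip filterc cost_filter
    (rg l l1 l2 (enc_list s) [::] k2 v [::] [::] [::] go nw [::] q pa)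
    (rg l l1 l2 [::] (enc_list (rev [seq u <- s | ~~ adj g u v])) k2 v [::] [::] [::]
       go nw (bit (has (fun u => adj g u v) s)) q pa).
Proof.
move=> us is_ hv; have [lM _] := size_s us is_.
pose St (done rest : seq word) :=
  rg l l1 l2 (enc_list rest) (enc_list (rev [seq u <- done | ~~ adj g u v])) k2 v
    [::] [::] [::] go nw (bit (has (fun u => adj g u v) done)) q pa.
eapply trip_le.
  apply: (@trip_each _ id rJ _ (6 * mc + 3 + cost_adj) St s) => // [done rest|].
    by rewrite map_id.
  move=> done w rest Es; rewrite /St filter_rcons has_rcons.
  have hw : w \in verts g.
    by apply: (indep_verts is_); rewrite Es mem_cat mem_head orbT.
  have sw := size_v1 hw; have sv := size_v1 hv.
  eapply trip_le.
    eapply trip_seq; first by apply: (@trip_dec M rJ rU w (enc_list rest)).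
    eapply trip_seq; first by apply: (@trip_cp M).
    rewrite /= cats0; eapply trip_seq; first exact: adjc_ok.
    eapply trip_seq.
      eapply (@trip_if _ _ _ _ (2 * mc + 1) _
       (rg l l1 l2 (enc_list rest) (enc_list (rev (if ~~ adj g w v
             then rcons [seq u <- done | ~~ adj g u v] w
             else [seq u <- done | ~~ adj g u v]))) k2 v [::] v [:: adj g w v] go nw
             (bit (adj g w v || has ((adj g)^~ v) done)) q pa)) => //; rewrite /=.
      case: (adj g w v) => /=; eapply trip_le.
      + eapply trip_seq; first by apply: (@trip_clr M).
        eapply trip_seq; first by apply: (@trip_clr M) => //=; apply: size_bit.
        exact: trip_push.
      + lia.
      + by eapply trip_post; [apply: (@trip_enc M)|rewrite /= rev_rcons].
      + lia.
    eapply trip_seq; first by apply: (@trip_clr M).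
    by apply: (@trip_clr M).
  lia.
by rewrite /cost_filter leq_add2r leq_mul2l lM orbT.
Qed.

Definition chk_in := While rK2 (dec rK2 rW ;; adjc ;; If rR Skip (clr rD) Skip ;;
  clr rR ;; clr rW).
Definition cost_chk_in := (4 * mc + 2 + cost_adj + 2) * M + 1.

Lemma chk_in_ok s u l l1 l2 j k v go nw d q pa : uniq s -> indep g s -> u \in verts g ->
  trip chk_in cost_chk_in
    (rg l l1 l2 j k (enc_list s) v u [::] [::] go nw (bit d) q pa)
    (rg l l1 l2 j k [::] v u [::] [::] go nw (bit (~~ has (adj g u) s && d)) q pa).
Proof.
move=> us is_ hu; have [lM _] := size_s us is_.
pose St (done rest : seq word) :=
  rg l l1 l2 j k (enc_list rest) v u [::] [::] go nw (bit (~~ has (adj g u) done && d)) q pa.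
eapply trip_le.
  eapply trip_post.
    apply: (@trip_each _ id rK2 _ (4 * mc + 2 + cost_adj) St s) => // [done rest|].
      by rewrite map_id.
    move=> done w rest Es; rewrite /St has_rcons.
    have hw : w \in verts g.
      by apply: (indep_verts is_); rewrite Es mem_cat mem_head orbT.
    have sw := size_v1 hw.
    eapply trip_le.
      eapply trip_seq; first by apply: (@trip_dec M rK2 rW w (enc_list rest)).
      rewrite /=; eapply trip_seq; first exact: adjc_ok.
      eapply trip_seq.
        eapply (@trip_if _ _ _ _ mc _ (rg l l1 l2 j k (enc_list rest) v u w [:: adj g u w]
         go nw (bit (~~ (adj g u w || has (adj g u) done) && d)) q pa)) => //; rewrite /=.
        case: (adj g u w) => /=.
          by apply: (@trip_clr M) => //=; apply: size_bit.
        by apply: trip_le (@trip_skip _) _.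
      eapply trip_seq; first by apply: (@trip_clr M).
      by apply: (@trip_clr M).
    lia.
  by [].
by rewrite /cost_chk_in leq_add2r leq_mul2l lM orbT.
Qed.

Definition chk_mid := While rJ (dec rJ rU ;; cp rK rK2 ;; chk_in ;; clr rU).
Definition cost_chk_mid := (3 * mc + cost_chk_in + 2) * M + 1.

Lemma chk_mid_ok t s l l1 l2 v go nw q pa :
  uniq s -> indep g s -> uniq t -> indep g t ->
  trip chk_mid cost_chk_mid
    (rg l l1 l2 (enc_list t) (enc_list s) [::] v [::] [::] [::] go nw [:: true] q pa)
    (rg l l1 l2 [::] (enc_list s) [::] v [::] [::] [::] go nw
       (bit (~~ has (fun u => has (adj g u) s) t)) q pa).
Proof.
move=> us is_ ut it; have [_ lM] := size_s us is_; have [lt _] := size_s ut it.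
pose St (done rest : seq word) := rg l l1 l2 (enc_list rest) (enc_list s) [::] v [::] [::] [::]
  go nw (bit (~~ has (fun u => has (adj g u) s) done)) q pa.
eapply trip_le.
  eapply trip_post.
    apply: (@trip_each _ id rJ _ (3 * mc + cost_chk_in) St t) => // [done rest|].
      by rewrite map_id.
    move=> done w rest Es; rewrite /St has_rcons.
    have hw : w \in verts g.
      by apply: (indep_verts it); rewrite Es mem_cat mem_head orbT.
    have sw := size_v1 hw.
    eapply trip_le.
      eapply trip_seq; first by apply: (@trip_dec M rJ rU w (enc_list rest)).
      eapply trip_seq; first by apply: (@trip_cp M) => //=; apply: leqW.
      rewrite /= cats0; eapply trip_seq; first exact: chk_in_ok.
      by eapply trip_post; [apply: (@trip_clr M)|rewrite /= negb_or].
    lia.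
  by [].
by rewrite /cost_chk_mid leq_add2r leq_mul2l lt orbT.
Qed.

(* No edge joins [s] and [t]; for maximal independent sets this means that they
   are equal. *)
Definition same (s t : seq word) := ~~ has (fun u => has (adj g u) s) t.

(** If [rD] survives [chk_mid], no edge joins the candidate to the listed set, and the candidate is
    no longer new. *)
Definition chk := cp rL rL2 ;; CPush rN true ;;
  While rL2 (dec rL2 rJ ;; CPush rD true ;; chk_mid ;; If rD Skip (CPop rD ;; clr rN) Skip).
Definition cost_chk := mc + 1 + ((2 * mc + 4 + cost_chk_mid + 2) * M + 1).

Lemma chk_ok Ls s l1 v go q pa : uniq s -> indep g s ->
  (forall t, t \in Ls -> uniq t /\ indep g t) ->
  size Ls <= M -> size (enc_list (map enc_list Ls)) <= M ->
  trip chk cost_chk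
    (rg (enc_list (map enc_list Ls)) l1 [::] [::] (enc_list s) [::] v [::] [::] [::] go [::]
      [::] q pa)
    (rg (enc_list (map enc_list Ls)) l1 [::] [::] (enc_list s) [::] v [::] [::] [::] go
       (bit (~~ has (same s) Ls)) [::] q pa).
Proof.
move=> us is_ HL hM hL.
set l := enc_list (map _ _) in hL *.
pose St (done rest : seq (seq word)) := rg l l1 (enc_list (map enc_list rest)) [::] (enc_list s)
  [::] v [::] [::] [::] go (bit (~~ has (same s) done)) [::] q pa.
eapply trip_le.
  eapply trip_seq; first by apply: (@trip_cp M) => //=; apply: leqW.
  rewrite /= cats0; eapply trip_seq; first exact: trip_push.
  apply: (@trip_each _ enc_list rL2 _ (2 * mc + 4 + cost_chk_mid) St Ls) => //.
  move=> done t rest Es; rewrite /St has_rcons.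
  have [ut it] : uniq t /\ indep g t by apply: HL; rewrite Es mem_cat mem_head orbT.
  have [_ ht] := size_s ut it.
  eapply trip_le.
    eapply trip_seq.
      by apply: (@trip_dec M rL2 rJ (enc_list t) (enc_list (map enc_list rest))) => //; apply: leqW.
    eapply trip_seq; first exact: trip_push.
    rewrite /=; eapply trip_seq; first exact: chk_mid_ok.
    rewrite /=; eapply (@trip_if _ _ _ _ (1 + mc)) => //; rewrite /=.
    rewrite -/(same s t); case: (same s t) => /=.
      eapply trip_seq; first exact: trip_pop.
      by apply: (@trip_clr M) => //=; apply: size_bit.
    by apply: trip_le (@trip_skip _) _.
  lia.
by rewrite /cost_chk addnA !leq_add2l leq_add2r leq_mul2l hM orbT.
Qed.

(** * Maximal independent sets through adjacency *)

Lemma indepP s : reflect ((forall u, u \in s -> u \in verts g) /\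
  (forall u v, u \in s -> v \in s -> ~~ adj g u v)) (indep g s).
Proof.
apply: (iffP andP) => [[/allP h1 /allP h2]|[h1 h2]]; split=> //.
- by move=> u v hu hv; have /allP/(_ _ hv) := h2 _ hu.
- exact/allP.
- by apply/allP => u hu; apply/allP => v hv; apply: h2.
Qed.

(** Otherwise [v :: s] would be independent, against maximality. *)
Lemma maximal_mem s v : maximal_indep g s -> v \in verts g ->
  (forall u, u \in s -> ~~ adj g u v) -> v \in s.
Proof.
move=> /andP[/indepP[h1 h2] /allP h3] hv H; have /orP[//|/negP[]] := h3 v hv.
apply/indepP; split=> [u|u w]; rewrite !inE.
  by case/predU1P => [->//|]; apply: h1.
case/predU1P => [->|hu]; case/predU1P => [->|hw]; rewrite ?adj_irr //.
- by rewrite adj_sym H.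
- exact: H.
- exact: h2.
Qed.

(** A member of one set has no neighbour in the other, hence belongs to it by [maximal_mem]. *)
Lemma same_mem s t : maximal_indep g s -> maximal_indep g t -> same s t -> s =i t.
Proof.
move=> ms mt /hasPn H; have /andP[/indepP[s1 s2] _] := ms.
have /andP[/indepP[t1 t2] _] := mt.
have K u w : u \in t -> w \in s -> ~~ adj g u w by move=> /H/hasPn; apply.
move=> w; apply/idP/idP => hw.
  by apply: (maximal_mem mt) => [|u hu]; [apply: s1|apply: K].
by apply: (maximal_mem ms) => [|u hu]; [apply: t1|rewrite adj_sym; apply: K].
Qed.

Lemma mem_same s t : indep g s -> s =i t -> same s t.
Proof.
move=> /indepP[_ h] E; apply/hasPn => u; rewrite -E => hu.
by apply/hasPn => w; apply: h.
Qed.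

(* If [v] has no neighbour in the maximal set [s], it is already in [s]: testing
   this avoids duplicating [v] without ever comparing words. *)
Definition seed v s :=
  let f := rev [seq u <- s | ~~ adj g u v] in
  if has (fun u => adj g u v) s then v :: f else f.

Lemma seed_ok v s : uniq s -> maximal_indep g s -> v \in verts g ->
  [/\ uniq (seed v s), indep g (seed v s), v \in seed v s &
      {subset [seq u <- s | ~~ adj g u v] <= seed v s}].
Proof.
move=> us ms hv; have /andP[/indepP[s1 s2] _] := ms; rewrite /seed.
have subf : {subset [seq u <- s | ~~ adj g u v] <= rev [seq u <- s | ~~ adj g u v]}.
  by move=> u; rewrite mem_rev.
case: ifP => [/hasP[u0 hu0 a0]|/negbT/hasPn Hn].
  split.
  - rewrite /= mem_rev mem_filter rev_uniq filter_uniq // andbT.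
    (* The neighbour [u0] of [v] in the independent set [s] keeps [v] out of [s]. *)
    by apply/negP => /andP[_ hvs]; move: (s2 _ _ hu0 hvs); rewrite a0.
  - apply/indepP; split=> [u|u w]; rewrite !inE !mem_rev !mem_filter.
      by case/predU1P => [->//|/andP[_]]; apply: s1.
    case/predU1P => [->|/andP[au hu]]; case/predU1P => [->|/andP[aw hw]] //.
    + by rewrite adj_irr.
    + by rewrite adj_sym.
    + exact: s2.
  - exact: mem_head.
  - by move=> u /subf hu; rewrite inE hu orbT.
split=> //.
- by rewrite rev_uniq filter_uniq.
- by apply/indepP; split=> [u|u w]; rewrite !mem_rev !mem_filter => /andP[_];
    [apply: s1|move=> hu /andP[_]; apply: s2].
- rewrite mem_rev mem_filter adj_irr /=.
  exact: (maximal_mem ms).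
Qed.

(** What an unsuccessful attempt with [v] and [s] leaves behind: [t] is the listed set equal to the
    extension of the seed. *)
Definition closed_for (Ls : seq (seq word)) v s := exists t,
  [/\ t \in Ls, v \in t & {subset [seq u <- s | ~~ adj g u v] <= t}].

Definition fresh (Ls : seq (seq word)) s :=
  [/\ uniq s, maximal_indep g s & ~~ has (same s) Ls].

(** On success, emptying [rL1] ends the loop over the answers and emptying [rPA] aborts the
    simulated enumerator. *)
Definition handler_body := dec rL1 rJ ;; filterc ;;
  If rD Skip (CPop rD ;; cp rV rW ;; enc rW rK) Skip ;; ext ;; chk ;;
  If rN Skip (CPop rN ;; CPush rG true ;; clr rL1 ;; clr rPA) (clr rK).
Definition handler := cp rL rL1 ;; While rL1 handler_body ;; clr rV.

Definition cost_body := 5 * mc + cost_filter + cost_ext + cost_chk + 10.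
Definition cost_handler := 2 * mc + ((cost_body + 2) * M + 1).

(** * Treatment of one node *)

Section Handler.
Variables (Ls : seq (seq word)) (v : word) (pa : word).
Hypothesis Ls_ok : forall t, t \in Ls -> uniq t /\ maximal_indep g t.
Hypothesis size_Ls : size Ls <= M.
Hypothesis size_encLs : size (enc_list (map enc_list Ls)) <= M.
Hypothesis v_vert : v \in verts g.
Hypothesis size_pa : size pa <= M.

Notation encLs := (enc_list (map enc_list Ls)).
Notation found s := (rg encLs [::] [::] [::] (enc_list s) [::] v [::] [::] [::]
  [:: true] [::] [::] [::] [::]).

Lemma handler_body_ok t rest : t \in Ls ->
  size (enc_list (map enc_list rest)) <= M ->
  (closed_for Ls v t /\ trip handler_body cost_body
    (rg encLs (enc_list (map enc_list (t :: rest))) [::] [::] [::] [::] v [::] [::] [::]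
       [::] [::] [::] [::] pa)
    (rg encLs (enc_list (map enc_list rest)) [::] [::] [::] [::] v [::] [::] [::]
       [::] [::] [::] [::] pa)) \/
  exists s, fresh Ls s /\ trip handler_body cost_body
    (rg encLs (enc_list (map enc_list (t :: rest))) [::] [::] [::] [::] v [::] [::] [::]
       [::] [::] [::] [::] pa) (found s).
Proof.
move=> ht hr; have [ut mt] := Ls_ok ht; have /andP[it _] := mt.
have [lt et] := size_s ut it; have sv := size_v1 v_vert.
have [us0 is0 vs0 ss0] := seed_ok ut mt v_vert.
have [s [us ms sub H]] := ext_ok encLs (enc_list (map enc_list rest)) [::] [::] [::] v
  [::] [::] [::] [::] [::] pa us0 is0.
have /andP[is_ _] := ms; have [_ es] := size_s us is_.
have spa : size pa <= M.+1 := leqW size_pa.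
have ses : size (enc_list s) <= M.+1 := leqW es.
have ser : size (enc_list (map enc_list rest)) <= M.+1 := leqW hr.
(* Everything before the final test runs alike in both outcomes. *)
have pre r' T : trip (If rN Skip (CPop rN ;; CPush rG true ;; clr rL1 ;; clr rPA) (clr rK))
    T (rg encLs (enc_list (map enc_list rest)) [::] [::] (enc_list s) [::] v [::] [::] [::]
       [::] (bit (~~ has (same s) Ls)) [::] [::] pa) r' -> T <= 2 * mc + 4 ->
   trip handler_body cost_body
    (rg encLs (enc_list (map enc_list (t :: rest))) [::] [::] [::] [::] v [::] [::] [::]
       [::] [::] [::] [::] pa) r'.
  move=> Hlast hT; eapply trip_le.
    eapply trip_seq.
      apply: (@trip_dec M rL1 rJ (enc_list t) (enc_list (map enc_list rest))) => //.
      exact: leqW.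
    eapply trip_seq; first exact: filterc_ok.
    eapply trip_seq.
      eapply (@trip_if _ _ _ _ (1 + (mc + mc)) _ (rg encLs (enc_list (map enc_list rest))
        [::] [::] (enc_list (seed v t)) [::] v [::] [::] [::] [::] [::] [::] [::] pa)) => //.
      rewrite /= /seed; case: has => /=; last by apply: trip_le (@trip_skip _) _.
      eapply trip_seq; first exact: trip_pop.
      eapply trip_seq; first by apply: (@trip_cp M).
      by rewrite /= cats0; apply: (@trip_enc M).
    eapply trip_seq; first exact: H.
    eapply trip_seq; last exact: Hlast.
    apply: chk_ok => // t' /Ls_ok[ut' /andP[it' _]] //.
  by rewrite /cost_body; move: hT; clear; lia.
(* Either no edge joins the extension to some listed set, which it then equals, or the extension is
   fresh. *)
case E: (has (same s) Ls) pre => /= pre.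
  left; split.
    have /hasP[t' ht' Et'] := E; exists t'; split=> //.
      by rewrite -(same_mem ms (Ls_ok ht').2 Et'); apply: sub.
    by move=> u /ss0/sub; rewrite (same_mem ms (Ls_ok ht').2 Et').
  apply: (pre _ (mc + 2)); last by clear; lia.
  by apply: trip_if => //=; apply: (@trip_clr M).
right; exists s; split; first by split=> //; rewrite E.
apply: (pre _ ((1 + (1 + (mc + mc))) + 2)); last by clear; lia.
apply: trip_if => //=.
eapply trip_seq; first exact: trip_pop.
eapply trip_seq; first exact: trip_push.
eapply trip_seq; first by apply: (@trip_clr M).
by apply: (@trip_clr M).
Qed.

Lemma handler_loop_ok rest : {subset rest <= Ls} ->
  size (enc_list (map enc_list rest)) <= M ->
  ((forall t, t \in rest -> closed_for Ls v t) /\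
   trip (While rL1 handler_body) ((cost_body + 2) * size rest + 1)
    (rg encLs (enc_list (map enc_list rest)) [::] [::] [::] [::] v [::] [::] [::]
       [::] [::] [::] [::] pa)
    (rg encLs [::] [::] [::] [::] [::] v [::] [::] [::]
       [::] [::] [::] [::] pa)) \/
  exists s, fresh Ls s /\
   trip (While rL1 handler_body) ((cost_body + 2) * size rest + 1)
    (rg encLs (enc_list (map enc_list rest)) [::] [::] [::] [::] v [::] [::] [::]
       [::] [::] [::] [::] pa) (found s).
Proof.
elim: rest => [|t rest IH] sub hm.
  by left; split=> //; rewrite muln0; apply: trip_while0.
have ht : t \in Ls by apply: sub; apply: mem_head.
have hm' : size (enc_list (map enc_list rest)) <= M.
  by apply: leq_trans hm; rewrite /= enc_list_cons size_cat leq_addl.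
have [|[cl H]|[s [fs H]]] := IH _ hm'; first by move=> u hu; apply: sub; rewrite inE hu orbT.
all: have [[cl0 H0]|[s0 [fs0 H0]]] := handler_body_ok ht hm'.
- left; split; first by move=> u; rewrite inE => /predU1P[->//|]; apply: cl.
  eapply trip_le; first by eapply trip_while1;
    [by []|exact: enc_list_cons_neq0|exact: H0|exact: H].
  by rewrite /= mulnS; lia.
all: right.
- exists s0; split=> //.
  eapply trip_le; first by eapply trip_while1;
    [by []|exact: enc_list_cons_neq0|exact: H0|exact: trip_while0].
  by rewrite /= mulnS; lia.
- exists s; split=> //.
  eapply trip_le; first by eapply trip_while1;
    [by []|exact: enc_list_cons_neq0|exact: H0|exact: H].
  by rewrite /= mulnS; lia.
- exists s0; split=> //.
  eapply trip_le; first by eapply trip_while1;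
    [by []|exact: enc_list_cons_neq0|exact: H0|exact: trip_while0].
  by rewrite /= mulnS; lia.
Qed.

Lemma handler_ok :
  ((forall t, t \in Ls -> closed_for Ls v t) /\
   trip handler cost_handler
    (rg encLs [::] [::] [::] [::] [::] v [::] [::] [::] [::] [::] [::] [::] pa)
    (rg encLs [::] [::] [::] [::] [::] [::] [::] [::] [::] [::] [::] [::] [::] pa)) \/
  exists s, fresh Ls s /\ trip handler cost_handler
    (rg encLs [::] [::] [::] [::] [::] v [::] [::] [::] [::] [::] [::] [::] pa)
    (rg encLs [::] [::] [::] (enc_list s) [::] [::] [::] [::] [::] [:: true] [::] [::] [::]
      [::]).
Proof.
have sv := size_v1 v_vert.
have pre r' r'' : trip (While rL1 handler_body) ((cost_body + 2) * size Ls + 1)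
    (rg encLs encLs [::] [::] [::] [::] v [::] [::] [::] [::] [::] [::] [::] pa) r' ->
    nth [::] r' rV = v -> set_nth [::] r' rV [::] = r'' ->
    trip handler cost_handler
    (rg encLs [::] [::] [::] [::] [::] v [::] [::] [::] [::] [::] [::] [::] pa) r''.
  move=> H Ev <-; eapply trip_le.
    eapply trip_seq; first by apply: (@trip_cp M) => //=; apply: leqW.
    rewrite /= cats0; eapply trip_seq; first exact: H.
    by apply: (@trip_clr M); rewrite ?Ev.
  have : (cost_body + 2) * size Ls <= (cost_body + 2) * M by rewrite leq_mul2l size_Ls orbT.
  by rewrite /cost_handler; lia.
have [[cl H]|[s [fs H]]] := @handler_loop_ok Ls (fun _ => id) size_encLs.
- by left; split=> //; apply: pre H _ _.
- by right; exists s; split=> //; apply: pre H _ _.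
Qed.
End Handler.

(** * One search over the nodes *)

Section Search.
Variables (AV : prog) (tA : nat) (outsA : seq (word * nat)) (TA : nat).
Hypothesis AV_halts : halts_with AV [:: x] outsA TA.
Hypothesis AV_verts : forall w, (w \in map fst outsA) = (w \in verts g).
Hypothesis AV_uniq : uniq (map fst outsA).
Hypothesis AV_time : forall o1 w tw o2, outsA = o1 ++ (w, tw) :: o2 ->
  tw <= (size o1).+1 * tA.
Hypothesis AV_total : TA <= (size outsA).+1 * tA.
Hypothesis size_AV : size AV <= M.

Variable Ls : seq (seq word).
Hypothesis Ls_ok : forall t, t \in Ls -> uniq t /\ maximal_indep g t.
Hypothesis Ls_neq0 : Ls <> [::].
Hypothesis size_Ls : size Ls <= M.
Hypothesis size_encLs : size (enc_list (map enc_list Ls)) <= M.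

Notation encLs := (enc_list (map enc_list Ls)).
Notation blank pa :=
  (rg encLs [::] [::] [::] [::] [::] [::] [::] [::] [::] [::] [::] [::] [::] pa).
Notation found s := (rg encLs [::] [::] [::] (enc_list s) [::] [::] [::] [::] [::]
  [:: true] [::] [::] [::] [::]).

Definition search := cp rX (fA 0) ;; goto AV rPA 0 ;; sim AV fA rPA rV handler ;;
  clears fA (nstk AV).

(** At most [M * M] nodes fail; the next output of the enumerator, or its halt, takes one further
    delay. *)
Definition time_A := (M * M).+1 * tA.
Definition cost_sim := sim_const AV * time_A + cost_handler * (M * M).+1 + sim_const AV.
Definition cost_search :=
  mc + (size AV + (cost_sim + nstk AV * (3 * (M + time_A) + 1))).

Definition closed_under (done : seq word) := forall v, v \in done -> v \in verts g /\
  forall t, t \in Ls -> closed_for Ls v t.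

(** The nodes that failed all lie in the union of at most [M] listed sets of at most [M] members.
    This keeps a search polynomial although the graph may have exponentially many nodes. *)
Lemma closed_size done : uniq done -> closed_under done -> size done <= M * M.
Proof.
move=> ud cl; apply: (@leq_trans (size (flatten Ls))).
  apply: uniq_leq_size => // v /cl[_ H]; case: (Ls) Ls_neq0 H => // t Ls' _ H.
  have [t' [ht' hv _]] := H t (mem_head _ _).
  by apply/flattenP; exists t'.
apply: leq_trans (leq_mul size_Ls (leqnn M)).
have : forall t, t \in Ls -> size t <= M.
  by move=> t /Ls_ok[ut /andP[it _]]; have [] := size_s ut it.
elim: (Ls) => //= t l IH H; rewrite size_cat mulSn leq_add ?H ?mem_head //.
by apply: IH => u hu; apply: H; rewrite inE hu orbT.
Qed.

(* [regs_are] up to the program counter and the stacks of the enumerator. *)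
Definition visible_regs r (s : state) :=
  (forall i, i < 18 -> i != rPA -> s i = nth [::] r i) /\ forall i, s (fE i) = [::].

(** An instance of [sim_run] whose outputs are the nodes. The stacks of the enumerator are emptied
    afterwards, also after an abort, so that the next search starts from scratch. *)
Lemma search_ok s : regs_are (fun _ => [::]) (blank [::]) s ->
  qrun search s cost_search (fun s' =>
    (regs_are (fun _ => [::]) (blank [::]) s' /\ closed_under (verts g)) \/
    exists2 s0, fresh Ls s0 & regs_are (fun _ => [::]) (found s0) s').
Proof.
case=> [R1 R2 R3].
have xx : s rX = x by rewrite R1.
apply: (@q_seq mc (size AV + (cost_sim + nstk AV * (3 * (M + time_A) + 1)))) => //.
apply: cp_ok => //; [by rewrite R1|by rewrite xx /mcost; move: size_x; lia|].
move=> s1 E1.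
apply: (@q_seq (size AV) (cost_sim + nstk AV * (3 * (M + time_A) + 1))) => //.
apply: goto_ok => //; first by rewrite E1 /upd /= R1.
move=> s2 E2; apply: (@q_seq cost_sim (nstk AV * (3 * (M + time_A) + 1))) => //.
have s2r i : i < 18 -> i != rPA -> s2 i = nth [::] (blank [::]) i.
  move=> hi ni; rewrite E2 /upd (negbTE ni) E1 /upd -R1 //.
  by case: eqP => // E; move: hi; rewrite E /fA; lia.
have s2E i : s2 (fE i) = [::].
  rewrite E2 /upd E1 /upd R3; case: eqP => [E|_]; first by move: E; rewrite /fE; lia.
  by case: eqP => // E; move: E; rewrite /fE /fA; lia.
have s2A i : s2 (fA i) = nth [::] [:: x] i.
  rewrite E2 /upd E1 /upd; case: eqP => [E|_]; first by move: E; rewrite /fA; lia.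
  by rewrite (inj_eq fA_inj) !R2 cats0; case: i => //= i; rewrite nth_nil.
have RA : sim_rel AV fA rPA (init [:: x]) s2 by split=> //; rewrite E2 /upd eqxx.
(* [closed_under done] is kept in [I] and in [A] alike: through [closed_size] it bounds the
   simulated time of complete and of aborted runs. *)
pose I done (s' : state) := visible_regs (blank [::]) s' /\ closed_under done.
pose A done (w : word) (s' : state) := closed_under done /\
  exists2 s0, fresh Ls s0 & visible_regs (found s0) s'.
have fr1 : forall i, [/\ fA i <> rPA, fA i <> rV & fA i <> TMP].
  by move=> i; split; rewrite /fA; lia.
have fr2 : [/\ rPA <> rV, rPA <> TMP & rV <> TMP] by [].
have visr i : i < 18 -> i != rPA -> visible fA rPA i.
  by move=> hi /eqP ni; split=> // j E; move: hi; rewrite E /fA; lia.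
have visE i : visible fA rPA (fE i) by split=> [j|]; rewrite /fA /fE; lia.
have Iext done sa sb : (forall j, visible fA rPA j -> sa j = sb j) -> I done sa -> I done sb.
  move=> E [[h1 h2] h3]; split=> //; split=> [i hi ni|i].
    by rewrite -E; [apply: h1|apply: visr].
  by rewrite -E; [apply: h2|apply: visE].
have Itmp done sa : I done sa -> sa TMP = [::].
  by case=> -[->].
have Ih done w rest sa c s0 : map fst outsA = done ++ w :: rest -> I done s0 ->
     (forall j, visible fA rPA j -> j <> rV -> sa j = s0 j) -> sa rV = w ++ s0 rV ->
     sim_rel AV fA rPA c sa ->
     qrun handler sa cost_handler (fun s' => (forall i, s' (fA i) = stk c i) /\
       (s' rPA = pcst AV (pc c) /\ I (rcons done w) s' \/ s' rPA = [::] /\ A done w s')).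
  move=> Eo [[h1 h2] h3] Ej Er [Ra Rb].
  have hw : w \in verts g by rewrite -AV_verts Eo mem_cat mem_head orbT.
  have spa : size (pcst AV (pc c)) <= M.
    by rewrite /pcst; case: ltnP => // h; rewrite size_nseq; apply: leq_trans size_AV.
  have reg : regs_are (stk c) (rg encLs [::] [::] [::] [::] [::] w [::] [::] [::] [::] [::]
      [::] [::] (pcst AV (pc c))) sa.
    split=> // [i hi|i]; last by rewrite Ej ?h2 //; rewrite /fE; lia.
    case: (eqVneq i rPA) => [->|ni]; first by rewrite Ra.
    case: (eqVneq i rV) => [->|/eqP nv]; first by rewrite Er h1 //= cats0.
    rewrite Ej ?h1 //; last exact: visr.
    by move: i hi ni nv {Ej Er}; do 18?[case=> //].
  have [[cl H]|[s3 [fs H]]] := handler_ok Ls_ok size_Ls size_encLs hw spa.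
    apply: q_mono (H _ _ reg) _ _ => // s' [g1 g2 g3]; split=> //; left.
    split; first by rewrite g1.
    split; first by split=> // i hi ni; rewrite g1 //; move: i hi ni; do 18?[case=> //].
    by move=> v; rewrite mem_rcons inE => /predU1P[->//|]; apply: h3.
  apply: q_mono (H _ _ reg) _ _ => // s' [g1 g2 g3]; split=> //; right.
  split; first by rewrite g1.
  by split=> //; exists s3 => //; split=> // i hi ni; rewrite g1.
have I0 : I [::] s2 by split.
have [k Ex] := AV_halts.
have main : qrun (sim AV fA rPA rV handler) s2 cost_sim (fun s3 =>
    [/\ I (map fst outsA) s3 \/ (exists2 s0, fresh Ls s0 & visible_regs (found s0) s3),
        s3 rPA = [::], forall i, nstk AV <= i -> s3 (fA i) = [::] &
        forall i, size (s3 (fA i)) <= M + time_A]).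
  move=> t1.
  have [s3 [t3 [c' [E p3 f3 n3 HH]]]] := @sim_run AV fA rPA rV handler fA_inj fr1
    fr2 cost_handler I A (map fst outsA) Iext Itmp Ih k (init [:: x]) 0 outsA TA Ex
    [::] s2 t1 RA I0 erefl.
  have n3' i : nstk AV <= i -> s3 (fA i) = [::].
    move=> hni; rewrite f3 n3 //= nth_default //.
    by apply: leq_trans hni; apply: ltnW; apply: ltnW; exact: nstk_ge3.
  have sx i : size (stk (init [:: x]) i) <= M.
    by case: i => [|i] /=; rewrite ?nth_nil.
  exists s3, t3; case: HH => [[h1 h2 h3]|[o1 [w [tw [o2 [h1 [cl fnd] h3 h4]]]]]].
    have so : size outsA <= M * M.
      by rewrite -(size_map fst); apply: closed_size => //; case: h1.
    have TAle : TA <= time_A.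
      by apply: leq_trans AV_total _; rewrite /time_A leq_mul2r ltnS so orbT.
    split=> //.
      have c1 := leq_mul (leqnn (sim_const AV)) TAle.
      have c2 : cost_handler * size outsA <= cost_handler * (M * M).+1.
        by rewrite leq_mul2l leqW // orbT.
      move: h2 c1 c2; rewrite /cost_sim muln0 addn0; clear; lia.
    split=> //; first by left.
    by move=> i; rewrite f3; have := h3 i; have := sx i; move: TAle; clear; lia.
  have so : size o1 <= M * M.
    rewrite -(size_map fst); apply: closed_size => //.
    by move: AV_uniq; rewrite h1 map_cat cat_uniq => /andP[].
  have TAle : tw <= time_A.
    by apply: leq_trans (AV_time h1) _; rewrite /time_A leq_mul2r ltnS so orbT.
  split=> //.
    have c1 := leq_mul (leqnn (sim_const AV)) TAle.
    have c2 : cost_handler * (size o1).+1 <= cost_handler * (M * M).+1.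
      by rewrite leq_mul2l ltnS so orbT.
    move: h3 c1 c2; rewrite /cost_sim muln0 addn0; clear; lia.
  split=> //; first by right.
  by move=> i; rewrite f3; have := h4 i; have := sx i; move: TAle; clear; lia.
apply: q_mono main _ _ => // s3 [HH p3 h4 h5].
apply: (clears_ok fA_inj h5) => // s4 g1 g2 g3.
have fA0 i : s4 (fA i) = [::] by case: (ltnP i (nstk AV)) => hni; [apply: g1|rewrite g2 ?h4].
have done_regs r : nth [::] r rPA = [::] -> visible_regs r s3 -> regs_are (fun _ => [::]) r s4.
  move=> hr [v1 v2]; split=> // i.
    move=> hi; rewrite g3; last by move=> j E; move: hi; rewrite E /fA; lia.
    by case: (eqVneq i rPA) => [->|ni]; [rewrite p3 hr|apply: v1].
  by rewrite g3 ?v2 // => j; rewrite /fA /fE; lia.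
case: HH => [[v1 cl]|[s0 fs v1]]; [left|right; exists s0 => //]; last exact: done_regs.
split; first exact: done_regs.
by move=> v hv; apply: cl; rewrite AV_verts.
Qed.
End Search.

End Subroutines.

(** * The enumeration *)

Section MainLoop.
Variables (x : word) (g : graph) (AE B AV : prog) (Mf tE tB tA : nat -> nat).
Hypothesis size_x : forall N, size x <= Mf N.
Hypothesis size_v : forall N v, v \in verts g -> size v <= Mf N.
Hypothesis size_s : forall N (s : seq word), uniq s -> indep g s ->
  size s <= Mf N /\ size (enc_list s) <= Mf N.
Hypothesis AE_ok : forall N u v, u \in verts g -> v \in verts g ->
  exists outs T, halts_with AE [:: x; u; v] outs T /\
    map fst outs = [:: [:: adj g u v]] /\ T <= tE (Mf N).
Hypothesis B_ok : forall N (s : seq word), uniq s -> indep g s ->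
  exists outs T, halts_with B [:: x; enc_list s] outs T /\ T <= tB (Mf N) /\
    exists o, map fst outs = [:: o] /\
      ((o = [:: false] /\ maximal_indep g s) \/
       (exists v, o = true :: v /\ v \in verts g /\ v \notin s /\ indep g (v :: s))).
Variables (outsA : seq (word * nat)) (TA : nat).
Hypothesis AV_halts : halts_with AV [:: x] outsA TA.
Hypothesis AV_verts : forall w, (w \in map fst outsA) = (w \in verts g).
Hypothesis AV_uniq : uniq (map fst outsA).
Hypothesis AV_time : forall N o1 w tw o2, outsA = o1 ++ (w, tw) :: o2 ->
  tw <= (size o1).+1 * tA (Mf N).
Hypothesis AV_total : forall N, TA <= (size outsA).+1 * tA (Mf N).
Hypothesis size_AV : forall N, size AV <= Mf N.

(** Distinctness is stated through [same], the form that [chk] decides; it does not depend on the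
    order in which a set is listed. *)
Definition answers (Ls : seq (seq word)) :=
  (forall t, t \in Ls -> uniq t /\ maximal_indep g t) /\
  pairwise (fun s t => ~~ same g s t) Ls.

Hypothesis size_answers : forall Ls, answers Ls ->
  size Ls <= Mf (size Ls) /\ size (enc_list (map enc_list Ls)) <= Mf (size Ls).
Variable K : nat.
Hypothesis answers_finite : forall Ls, answers Ls -> size Ls <= K.

Notation regs l k go := [:: x; [::]; l; [::]; [::]; [::]; k; [::]; [::]; [::]; [::]; [::];
  go; [::]; [::]; [::]; [::]; [::]].
Notation clean := (fun=> [::]).

Definition main_tail :=
  (cp rK rW ;; enc rW rL ;; clr rK ;; CPop rG) ;; search AE B AV.
Definition main_body := COut rK ;; main_tail.
(** The first answer extends the empty set, so every search runs with a nonempty list of answers.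
    [rG] is reset before each search and set again only by a successful one. *)
Definition main := (ext B ;; CPush rG true) ;; While rG main_body.

(** The term [cost_ext] covers the initial extension, so that one bound serves the first delay too.
    The summand [m] in [cost_delay] pays for printing an answer. *)
Definition cost_round m := cost_ext B m (tB m) + 3 * mcost m +
  cost_search AE B m (tE m) (tB m) AV (tA m) + 10.
Definition cost_delay m := cost_round m + m + 5.

Lemma answers_cons (Ls : seq (seq word)) (s : seq word) :
  answers Ls -> fresh g Ls s -> answers (s :: Ls).
Proof.
move=> [h1 h2] [us ms ns]; split=> [t|].
  by rewrite inE => /predU1P[->//|]; apply: h1.
by rewrite /= h2 andbT all_predC.
Qed.

Lemma main_tail_ok (Ls : seq (seq word)) (s : seq word) st : answers (s :: Ls) ->
  regs_are clean (regs (enc_list (map enc_list Ls)) (enc_list s) [:: true]) st ->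
  qrun main_tail st (cost_round (Mf (size Ls).+1)) (fun st' =>
   (regs_are clean (regs (enc_list (map enc_list (s :: Ls))) [::] [::]) st' /\
     closed_under g (s :: Ls) (verts g)) \/
   exists2 s', fresh g (s :: Ls) s' & regs_are clean
     (regs (enc_list (map enc_list (s :: Ls))) (enc_list s') [:: true]) st').
Proof.
move=> ans R; set N := (size Ls).+1; set M := Mf N.
have [us ms] := ans.1 s (mem_head _ _); have /andP[is_ _] := ms.
have [_ es] := size_s N us is_; have es1 : size (enc_list s) <= M.+1 := leqW es.
have [sz1 sz2] := size_answers ans.
apply: (@q_seq (3 * mcost M + 1) (cost_search AE B M (tE M) (tB M) AV (tA M))); last first.
  by rewrite /cost_round -/M; clear; lia.
have H : trip (cp rK rW ;; enc rW rL ;; clr rK ;; CPop rG) (3 * mcost M + 1)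
    (regs (enc_list (map enc_list Ls)) (enc_list s) [:: true])
    (regs (enc_list (map enc_list (s :: Ls))) [::] [::]).
  eapply trip_le.
    eapply trip_seq; first by apply: (@trip_cp M).
    rewrite /= cats0; eapply trip_seq; first by apply: (@trip_enc M).
    eapply trip_seq; first by apply: (@trip_clr M).
    exact: trip_pop.
  by clear; lia.
apply: q_mono (H _ _ R) (leqnn _) _ => st1 R1.
by apply: (search_ok (size_x N) (@size_v N) (@size_s N) (@AE_ok N) (@B_ok N) AV_halts
  AV_verts AV_uniq (@AV_time N) (AV_total N) (size_AV N) ans.1).
Qed.

(* [t0] is the time of the previous output. *)
Lemma main_loop_ok (Ls : seq (seq word)) (s : seq word) st t0 t : answers (s :: Ls) ->
  regs_are clean (regs (enc_list (map enc_list Ls)) (enc_list s) [:: true]) st ->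
  t <= t0 + cost_round (Mf (size Ls)) + 2 ->
  exists st' t' o ss, [/\ ev (While rG main_body) st t st' t' o,
    map fst o = map enc_list ss, answers (catrev ss Ls),
    closed_under g (catrev ss Ls) (verts g) /\ catrev ss Ls <> [::] &
    forall i, i <= size o ->
      nth 0 (pairmap (fun a b => b - a) t0 (rcons (map snd o) t')) i
        <= cost_delay (Mf (size Ls + i))].
Proof.
(* Termination comes from the bound [K] on the number of answers, however large; time is controlled
   delay by delay. *)
have [n Hn] : exists n, K - size Ls = n by eexists.
elim: n Ls s st t0 t Hn => [|n IH] Ls s st t0 t Hn ans R ht.
  by have := answers_finite ans; move: Hn => /=; lia.
have [r1 _ _] := R.
have [us ms] := ans.1 s (mem_head _ _); have /andP[is_ _] := ms.
have [_ es] := size_s (size Ls) us is_.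
have EK : st rK = enc_list s by rewrite r1.
set t1 := t + 1 + (size (st rK)).+1.
have nG : st rG <> [::] by rewrite r1.
have d0 : t1 - t0 <= cost_delay (Mf (size Ls + 0)).
  by rewrite addn0 /cost_delay /t1 EK; move: ht es; clear; lia.
have [st2 [t2 [E2 le2 [[R2 cl]|[s' fs R2]]]]] := main_tail_ok ans R t1.
  exists st2, (t2 + 1 + 1), [:: (st rK, t1)], [:: s]; split=> //.
  - apply: (ev_while1 (o1 := [:: (st rK, t1)]) (o2 := [::]) nG _ (ev_while0 _ _ _)).
      exact: (ev_seq (ev_out _ _ _) E2).
    by have [-> ] := R2.
  - by rewrite /= EK.
  - case=> [|[|i]] //= _; rewrite [size Ls + 1]addn1.
    by move: le2; rewrite /cost_delay; clear; lia.
have ans' := answers_cons ans fs.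
have [||st3 [t3 [o [ss [E3 o3 a3 c3 d3]]]]] := IH (s :: Ls) s' st2 t1 (t2 + 1) _ ans' R2.
- by move: Hn => /=; clear; lia.
- by move: le2 => /=; clear; lia.
exists st3, t3, ((st rK, t1) :: o), (s :: ss); split=> //.
- apply: (ev_while1 (o1 := [:: (st rK, t1)]) (o2 := o) nG _ E3).
  exact: (ev_seq (ev_out _ _ _) E2).
- by rewrite /= EK o3.
(* The delay of index [i + 1] is that of index [i] for the rest of the run, where one more answer is
   listed. *)
case=> [|i] //= hi; rewrite addnS -addSn; exact: d3.
Qed.

(** [ss] is in printing order, whereas the stored list grows at its front; hence [catrev]. *)
Lemma main_ok : exists o T, [/\ halts_with (compile main 0) [:: x] o T,
  exists ss, [/\ map fst o = map enc_list ss, answers (catrev ss [::]),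
    closed_under g (catrev ss [::]) (verts g) & catrev ss [::] <> [::]] &
  forall i, i <= size o -> nth 0 (delays o T) i <= cost_delay (Mf i)].
Proof.
have i0 : indep g [::] by [].
have [s [us ms _ H]] := ext_ok (s := [::]) (size_x 0) (@size_v 0) (@size_s 0) (@B_ok 0)
  [::] [::] [::] [::] [::] [::] [::] [::] [::] [::] [::] [::] isT i0.
have R0 : regs_are clean (regs [::] [::] [::]) (init [:: x]).(stk).
  by split=> i; [do 18?[case: i => [|i] //]|..].
have H' : trip (ext B ;; CPush rG true) (cost_ext B (Mf 0) (tB (Mf 0)) + 1)
   (regs [::] [::] [::]) (regs [::] (enc_list s) [:: true]).
  by eapply trip_seq; [exact: H|exact: trip_push].
have [st1 [t1 [E1 le1 R1]]] := H' _ _ R0 0.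
have ans : answers [:: s] by split=> // t; rewrite inE => /eqP ->.
have [|st2 [t2 [o [ss [E2 o2 a2 [c2 n2] d2]]]]] :=
  @main_loop_ok [::] s st1 0 t1 ans R1; first by move: le1; rewrite /cost_round /=; clear; lia.
exists o, t2; split=> //; last by exists ss.
apply: (@compile_halts _ _ st2).
exact: (ev_seq (o1 := [::]) E1 E2).
Qed.
End MainLoop.

(** * Unique decoding *)

Lemma enc_word_inj w1 w2 r1 r2 : enc_word w1 ++ r1 = enc_word w2 ++ r2 ->
  w1 = w2 /\ r1 = r2.
Proof.
(* A letter starts with [true] and the terminator with [false], so both words end together. *)
elim: w1 w2 => [|b1 w1 IH] [|b2 w2] //; first by case.
by rewrite !enc_wordE !cat_cons => -[-> /IH[-> ->]].
Qed.

Lemma enc_list_inj : injective enc_list.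
Proof.
elim=> [|w1 s1 IH] [|w2 s2] //.
- by rewrite enc_list_cons; case: w2.
- by rewrite enc_list_cons; case: w1.
- by rewrite !enc_list_cons => /enc_word_inj[-> /IH ->].
Qed.

Lemma represents_enc s t : represents (enc_list t) s = perm_eq t s.
Proof.
apply/mapP/idP => [[s' hs' /enc_list_inj ->]|h]; first by rewrite -mem_permutations.
by exists t; rewrite ?mem_permutations.
Qed.

Lemma size_enc_list b (s : seq word) : (forall v, v \in s -> size v <= b) ->
  size (enc_list s) <= size s * (2 * b + 2).
Proof.
elim: s => // v s IH H; rewrite enc_list_cons size_cat size_enc_word
  [size (v :: s)]/= (mulSn (size s)).
have h1 := H v (mem_head _ _); apply: leq_add; first by rewrite leq_add2r leq_mul2l h1 orbT.
by apply: IH => u hu; apply: H; rewrite inE hu orbT.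
Qed.

(** * Times and sizes of outputs *)

Notation delays_from t0 outs T :=
  (pairmap (fun a b => b - a) t0 (rcons (map snd outs) T)).

(** The delays telescope. *)
Lemma output_time b outs T t0 : (forall d, d \in delays_from t0 outs T -> d <= b) ->
  T <= t0 + (size outs).+1 * b /\
  forall o1 (w : word) tw o2, outs = o1 ++ (w, tw) :: o2 -> tw <= t0 + (size o1).+1 * b.
Proof.
elim: outs t0 => [|[w t] outs IH] t0 H.
  split; last by case.
  by have := H (T - t0) (mem_head _ _); rewrite mul1n; lia.
have h0 := H (t - t0) (mem_head _ _).
have [h1 h2] := IH t (fun d hd => H d (mem_behead (s := _ :: _) hd)).
split; first by rewrite /= mulSn; lia.
case=> [|p o1] w' tw o2 /=; first by case=> _ <- _; rewrite mul1n; lia.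
case=> _ E; by have := h2 _ _ _ _ E; rewrite /= (mulSn _.+1); lia.
Qed.

(** Printing a word costs more than its length, within a single delay; applied to the node
    enumerator, this bounds the length of the nodes. [t0] is the time of the last output. *)
Lemma output_size P b k c t t0 outs T : exec P k c t = (outs, Some T) -> t0 <= t ->
  (forall d, d \in delays_from t0 outs T -> d <= b) ->
  forall w, w \in map fst outs -> size w <= b.
Proof.
elim: k c t t0 outs => [|k IH] c t t0 outs //=.
case E: (step P c) => [[[c' o] d]|]; last by move=> [<-].
case: o E => [w0|] E; last first.
  by move=> Ex le; apply: (IH _ _ _ _ Ex); lia.
have [d1 s1] : 0 < d /\ size w0 < d.
  by move: E; rewrite /step; case: nth => //= a [_ <- <-].
case Ex: (exec P k c' (t + d)) => [outs1 oT] /= [<- ET] le H w; subst oT.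
rewrite inE => /predU1P[->|]; last first.
  by apply: (IH _ _ _ _ Ex (leqnn _)) => d' hd; apply: H; rewrite /= inE hd orbT.
apply: leq_trans (ltnW s1) (leq_trans _ (H (t + d - t0) (mem_head _ _))); lia.
Qed.

(** * Finiteness and completeness of the answers *)

Section Answers.
Variable g : graph.

(** Distinct answers have distinct indicator vectors over [verts g]. *)
Lemma answers_finite (Ls : seq (seq word)) :
  answers g Ls -> size Ls <= #|{: (size (verts g)).-tuple bool}|.
Proof.
case=> h1 h2; pose f (t : seq word) : (size (verts g)).-tuple bool :=
  map_tuple (fun v => v \in t) (in_tuple (verts g)).
rewrite -(size_map f); suff /card_uniqP <- : uniq (map f Ls) by apply: max_card.
rewrite uniq_pairwise pairwise_map; apply: (sub_in_pairwise (P := mem Ls)) h2.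
  move=> s t /h1[_ ms] /h1[_ mt]; apply: contra => /eqP/(congr1 val) /= E.
  have /andP[is_ _] := ms; have /andP[it _] := mt.
  apply: mem_same => // v; case: (boolP (v \in verts g)) => hv.
    by have /eq_in_map := E; apply.
  apply/idP/idP => h; case/negP: hv; [exact: indep_verts is_ h|exact: indep_verts it h].
by apply/allP.
Qed.

(* By induction on [n]: as long as [s] is not among the answers, the closure
   property yields an answer sharing one more node with [s]. *)
Lemma closed_complete (Ls : seq (seq word)) (s : seq word) :
  answers g Ls -> closed_under g Ls (verts g) -> Ls <> [::] ->
  uniq s -> maximal_indep g s -> exists2 t, t \in Ls & s =i t.
Proof.
move=> [h1 _] cl n0 us ms; have /andP[/indepP[s1 s2] _] := ms.
suff main n : (exists2 t, t \in Ls & s =i t) \/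
    exists2 t, t \in Ls & n <= count (fun v => v \in t) s.
  (* No set shares more than [size s] nodes with [s], so the first alternative holds. *)
  have [//|[t _]] := main (size s).+1.
  by rewrite ltnNge count_size.
elim: n => [|n [|[t ht hn]]]; [|by left|].
  by right; case: (Ls) n0 => // t l _; exists t => //; apply: mem_head.
have [ut mt] := h1 t ht; have /andP[/indepP[t1 t2] _] := mt.
case: (boolP (all (fun v => v \in t) s)) => [/allP sub|/allPn[v hv nv]].
  (* If [t] contains [s], the maximality of [s] makes them equal. *)
  left; exists t => // w; apply/idP/idP => [/sub //|hw].
  by apply: (maximal_mem ms) => [|u /sub hu]; [apply: t1|apply: t2].
right; have [hvv /(_ t ht)[t' [ht' hv' sub]]] := cl v (s1 _ hv).
exists t' => //; apply: leq_ltn_trans hn _.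
(* Members of [s] are not adjacent to [v], so those in [t] survive the filter. *)
have sub1 : {in s, subpred (fun u => (u \in t) || (u == v)) (fun u => u \in t')}.
  move=> u hu /orP[hut|/eqP -> //]; apply: sub.
  by rewrite mem_filter hut andbT s2.
apply: (@leq_trans (count (fun u => (u \in t) || (u == v)) s)); last first.
  rewrite -(eq_in_count (a1 := fun u => ((u \in t) || (u == v)) && (u \in t'))); last first.
    move=> u hu /=; case: (boolP (_ || _)) => //= h; exact: sub1.
  by apply: sub_count => u /andP[].
(* The two classes are disjoint since [v] is not in [t], and the second counts exactly one. *)
have <- : count (fun u => u \in t) s + count (fun u => u == v) s =
   count (fun u => (u \in t) || (u == v)) s.
  rewrite -count_predUI [X in _ + X](_ : _ = 0) ?addn0 // -(count_pred0 s).
  by apply: eq_count => u /=; case: eqP => [->|]; rewrite ?andbF // (negbTE nv).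
by rewrite -addn1 leq_add2l (count_uniq_mem v us) hv.
Qed.
End Answers.

(** * Polynomial bounds *)

Definition poly (f : nat -> nat) := exists c, forall n, f n <= (n + 2) ^ c.

Lemma poly_le f h : (forall n, f n <= h n) -> poly h -> poly f.
Proof. by move=> H [c Hc]; exists c => n; apply: leq_trans (H n) (Hc n). Qed.

Lemma poly_const k : poly (fun _ => k).
Proof.
exists k => n; apply: (@leq_trans (2 ^ k)); first exact/ltnW/ltn_expl.
by case: (k) => // j; rewrite leq_exp2r // leq_addl.
Qed.

Lemma poly_id : poly (fun n => n).
Proof. by exists 1 => n; rewrite expn1 leq_addr. Qed.

Lemma poly_exp2 n a b : a <= b -> (n + 2) ^ a <= (n + 2) ^ b.
Proof. by move=> h; rewrite leq_pexp2l // addn2. Qed.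

Lemma poly_add f h : poly f -> poly h -> poly (fun n => f n + h n).
Proof.
(* The base is at least 2, so one extra factor absorbs a sum of two terms. *)
move=> [a Ha] [b Hb]; exists (maxn a b).+1 => n.
have h1 := leq_trans (Ha n) (poly_exp2 n (leq_maxl a b)).
have h2 := leq_trans (Hb n) (poly_exp2 n (leq_maxr a b)).
by rewrite expnS; nia.
Qed.

Lemma poly_mul f h : poly f -> poly h -> poly (fun n => f n * h n).
Proof. by move=> [a Ha] [b Hb]; exists (a + b) => n; rewrite expnD leq_mul. Qed.

Lemma poly_succ f : poly f -> poly (fun n => (f n).+1).
Proof.
move=> h; apply: (@poly_le _ (fun n => f n + 1)); first by move=> n; rewrite addn1.
exact: poly_add h (poly_const 1).
Qed.

Lemma poly_comp f h : poly f -> poly h -> poly (fun n => f (h n)).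
Proof.
(* The exponent comes from [(n + 2) ^ b + 2 <= (n + 2) ^ b.+2]. *)
move=> [a Ha] [b Hb]; exists (b.+2 * a) => n; apply: leq_trans (Ha _) _.
rewrite expnM; case: a {Ha} => // a; rewrite leq_exp2r //.
have := Hb n; have : 0 < (n + 2) ^ b by rewrite expn_gt0 addn2.
by rewrite !expnS; nia.
Qed.

Lemma poly_pbound c : poly (pbound c).
Proof.
apply: poly_mul (poly_const c) _.
elim: (c) => [|k IH]; first exact: (poly_const 1).
apply: (@poly_le _ (fun n => n.+1 * n.+1 ^ k)); first by move=> n; rewrite expnS.
exact: poly_mul (poly_succ poly_id) IH.
Qed.

Lemma poly_pboundE f : poly f -> exists c, forall n, f n <= pbound c n.
Proof.
(* From [n + 2 <= 2 * n.+1] comes the factor [2 ^ c], which also exceeds the exponent [c]. *)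
move=> [c Hc]; exists (2 ^ c) => n; apply: leq_trans (Hc n) _.
apply: (@leq_trans ((2 * n.+1) ^ c)).
  by case: (c) => // k; rewrite leq_exp2r //; lia.
by rewrite expnMn /pbound leq_mul2l leq_pexp2l ?orbT // ltnW // ltn_expl.
Qed.

Ltac polys := repeat first
  [ exact: poly_const | exact: poly_id | assumption | apply: poly_add | apply: poly_mul
  | apply: poly_succ ].

Lemma poly_mcost : poly mcost.
Proof. by rewrite /mcost; polys. Qed.

Lemma poly_call_cost P t : poly t -> poly (fun m => call_cost P m.+1 (t m)).
Proof. by move=> ht; rewrite /call_cost; polys. Qed.

Lemma poly_cost_delay AE B AV tE tB tA : poly tE -> poly tB -> poly tA ->
  poly (cost_delay AE B AV tE tB tA).
Proof.
move=> hE hB hA; have h0 := poly_mcost.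
have h1 := poly_call_cost AE hE; have h2 := poly_call_cost B hB.
have h3 : poly (fun m => cost_adj AE m (tE m)) by rewrite /cost_adj; polys.
have h4 : poly (fun m => cost_ext B m (tB m)) by rewrite /cost_ext /cost_extB; polys.
have h5 : poly (fun m => cost_chk AE m (tE m)).
  by rewrite /cost_chk /cost_chk_mid /cost_chk_in; polys.
have h6 : poly (fun m => cost_handler AE B m (tE m) (tB m)).
  by rewrite /cost_handler /cost_body /cost_filter; polys.
have h7 : poly (fun m => time_A m (tA m)) by rewrite /time_A; polys.
rewrite /cost_delay /cost_round /cost_search /cost_sim; polys.
Qed.

(** * Choice of the bounds and conclusion *)

Lemma leq_pbound c m n : m <= n -> pbound c m <= pbound c n.
Proof. by move=> h; rewrite /pbound leq_mul2l; case: c => // c; rewrite leq_exp2r. Qed.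

Lemma count_pairwise_le1 (T : eqType) (r : rel T) (a : pred T) l : pairwise r l ->
  (forall u v, u \in l -> v \in l -> a u -> a v -> ~~ r u v) -> count a l <= 1.
Proof.
elim: l => //= u l IH /andP[/allP ru pl] H.
case: (boolP (a u)) => au /=; last first.
  by apply: IH => // v w hv hw; apply: H; rewrite inE ?hv ?hw orbT.
rewrite add1n ltnS leqNgt -has_count; apply/hasPn => v hv; apply/negP => av.
by have := H u v (mem_head _ _); rewrite inE hv orbT ru // => /(_ isT au av).
Qed.

Theorem theorem5 (G : word -> graph) (AV AE : prog) :
  polynomial_SGR G AV AE ->
  poly_expansion G ->
  exists P : prog, mis_enumerator_incpoly G P.
Proof.
move=> [[cA HA] [cE HE]] [[cI HI] [B [cB HB]]].
(* [E] bounds an encoded independent set: [pbound cI] nodes of length at most [pbound cA], each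
   letter taking two bits and each terminator two more. *)
pose E m := pbound cI m * (2 * pbound cA m + 2).
(* [F] adds up all size bounds; its last term is for the encoded list of at most [m] answers. *)
pose F m := m + size AV + pbound cA m + pbound cI m + E m + m * (2 * E m + 2).
(* [m + m]: the instance and the encoded set each have size at most [m]. *)
pose tE := pbound cE; pose tA := pbound cA; pose tB m := pbound cB (m + m).
have hA : poly tA := poly_pbound cA; have hE : poly tE := poly_pbound cE.
have hI := poly_pbound cI.
have hB : poly tB by apply: (poly_comp (poly_pbound cB)); polys.
have hEE : poly E by rewrite /E; polys.
have hF : poly F by rewrite /F; polys.
have [c Hc] := poly_pboundE (poly_comp (poly_cost_delay AE B AV hE hB hA) hF).
exists (compile (main AE B AV) 0), c => x.
have [outsA [TA [AVh [AV1 [AV2 AV3]]]]] := HA x.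
set g := G x in AV1 AV2 *; set n := size x in AV3.
pose Mf N := F (n + N).
have nMf N : n <= n + N by rewrite leq_addr.
have AV_verts w : (w \in map fst outsA) = (w \in verts g).
  apply/idP/idP => [/AV1 //|/AV2 h].
  by rewrite -has_pred1 has_count h.
have AV_uniq : uniq (map fst outsA).
  apply: count_mem_uniq => v; rewrite AV_verts; case: (boolP (v \in verts g)) => hv.
    exact: AV2.
  by apply/count_memPn; rewrite AV_verts.
have [AV_total0 AV_time0] := output_time AV3; rewrite add0n in AV_total0.
have size_v0 v : v \in verts g -> size v <= pbound cA n.
  have [k Ex] := AVh; rewrite -AV_verts.
  by apply: (output_size Ex (leqnn 0)) => d /AV3.
have size_s0 (s : seq word) : uniq s -> indep g s ->
    size s <= pbound cI n /\ size (enc_list s) <= E n.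
  move=> us is_; have hs := HI x s us is_; split=> //.
  apply: leq_trans (size_enc_list (b := pbound cA n) _) _.
    by move=> v /(indep_verts is_); apply: size_v0.
  by rewrite leq_mul2r hs orbT.
have mA N : pbound cA n <= pbound cA (n + N) by apply: leq_pbound.
have mI N : pbound cI n <= pbound cI (n + N) by apply: leq_pbound.
have mE N : E n <= E (n + N) by rewrite /E leq_mul // leq_add2r leq_mul2l mA orbT.
have F_ge N : [/\ n + N <= Mf N, size AV <= Mf N, pbound cA n <= Mf N, pbound cI n <= Mf N &
    E n + N * (2 * E n + 2) <= Mf N].
  have : N * (2 * E n + 2) <= (n + N) * (2 * E (n + N) + 2).
    by rewrite leq_mul ?leq_addl // leq_add2r leq_mul2l mE orbT.
  have := mA N; have := mI N; have := mE N; rewrite /Mf /F; clear => h1 h2 h3 h4.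
  by split; lia.
have Mn N : n <= Mf N by have [h _ _ _ _] := F_ge N; apply: leq_trans h; apply: nMf.
have Mv N v : v \in verts g -> size v <= Mf N.
  by move=> /size_v0 h; have [_ _ hh _ _] := F_ge N; apply: leq_trans h hh.
have Ms N (s : seq word) : uniq s -> indep g s ->
    size s <= Mf N /\ size (enc_list s) <= Mf N.
  move=> us is_; have [h1 h2] := size_s0 s us is_; have [_ _ _ hh1 hh2] := F_ge N.
  split; first exact: leq_trans h1 hh1.
  by apply: leq_trans h2 (leq_trans (leq_addr _ _) hh2).
have AEh N u v : u \in verts g -> v \in verts g -> exists outs T,
    halts_with AE [:: x; u; v] outs T /\ map fst outs = [:: [:: adj g u v]] /\ T <= tE (Mf N).
  move=> hu hv; have [outs [T [h1 [h2 h3]]]] := HE x u v hu hv.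
  by exists outs, T; split=> //; split=> //; apply: leq_trans h3 (leq_pbound _ (Mn N)).
have Bh N (s : seq word) : uniq s -> indep g s -> exists outs T,
    halts_with B [:: x; enc_list s] outs T /\ T <= tB (Mf N) /\
    exists o, map fst outs = [:: o] /\
      ((o = [:: false] /\ maximal_indep g s) \/
       (exists v, o = true :: v /\ v \in verts g /\ v \notin s /\ indep g (v :: s))).
  move=> us is_; have [outs [T [h1 [h2 h3]]]] := HB x s us is_.
  exists outs, T; split=> //; split=> //; apply: leq_trans h2 (leq_pbound _ _).
  by apply: leq_add; [apply: Mn|case: (Ms N s us is_)].
have AVt N o1 (w : word) tw o2 : outsA = o1 ++ (w, tw) :: o2 ->
    tw <= (size o1).+1 * tA (Mf N).
  move=> /AV_time0 h; apply: leq_trans h _.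
  by rewrite add0n leq_mul2l leq_pbound ?orbT.
have AVT N : TA <= (size outsA).+1 * tA (Mf N).
  by apply: leq_trans AV_total0 _; rewrite leq_mul2l leq_pbound ?orbT.
have AVs N : size AV <= Mf N by case: (F_ge N).
have Mans Ls : answers g Ls ->
    size Ls <= Mf (size Ls) /\ size (enc_list (map enc_list Ls)) <= Mf (size Ls).
  move=> [ans _]; have [h1 _ _ _ h2] := F_ge (size Ls).
  split; first by apply: leq_trans h1; apply: leq_addl.
  apply: leq_trans (size_enc_list (b := E n) _) _; last first.
    by rewrite size_map; apply: leq_trans (leq_addl _ _) h2.
  move=> w /mapP[t ht ->]; have [ut /andP[it _]] := ans t ht.
  by have [] := size_s0 t ut it.
have [o [T [Hh [ss [Eo ans cl n0]] Hd]]] :=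
  main_ok Mn Mv Ms AEh Bh AVh AV_verts AV_uniq AVt AVT AVs Mans (@answers_finite g).
have in_ss t : (t \in catrev ss [::]) = (t \in ss) by rewrite mem_rev.
have [okss dist] := ans.
exists o, T; split=> //; split; last split; last first.
- by move=> i hi; apply: leq_trans (Hd i hi) (Hc _).
- move=> s us ms; rewrite Eo count_map (eq_count (a2 := fun t => perm_eq t s)); last first.
    by move=> t /=; rewrite represents_enc.
  have [t ht Et] := closed_complete ans cl n0 us ms.
  have [ut mt] := okss t ht.
  (* At most once, since no edge would join two answers with the members of [s]; at least once, by
     completeness. *)
  rewrite -(count_rev _ ss); apply/eqP; rewrite eqn_leq; apply/andP; split.
    apply: (count_pairwise_le1 dist) => t1 t2 /okss[_ /andP[i1 _]] _ p1 p2.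
    by rewrite negbK mem_same // => w; rewrite (perm_mem p1) (perm_mem p2).
  rewrite -has_count; apply/hasP; exists t => //.
  by apply: uniq_perm => // w; rewrite Et.
- move=> w; rewrite Eo => /mapP[s]; rewrite -in_ss => /okss[us ms] ->.
  by exists s; split=> //; split=> //; rewrite represents_enc.
Qed.
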